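(* If $(X,\mathcal{E})$ and $(Y,\mathcal{F})$ are uniformly locally finite coarse spaces such that both $(X,\mathcal{E})$ and $(Y,\mathcal{F})$ coarsely embed into a Hilbert space, then every isomorphism between $\mathrm{C}^*_u(X)$ and $\mathrm{C}^*_u(Y)$ is rigidly implemented.
   Context: Coarse structures. A coarse structure on a set $X$ is a collection $\mathcal{E}$ of subsets of $X\times X$ (called entourages) which contains the diagonal $\Delta_X=\{(x,x): x\in X\}$ and is closed under taking subsets, inverses $E^{-1}=\{(x,y):(y,x)\in E\}$, finite unions, and compositions $E\circ F=\{(x,y): \exists z\ (x,z)\in E,\ (z,y)\in F\}$; $(X,\mathcal{E})$ is a coarse space. It is uniformly locally finite if $\sup_{x\in X}|\{y\in X:(x,y)\in E\}|<\infty$ for all $E\in\mathcal{E}$. The bounded coarse structure of a metric space $(X,d)$ is the smallest coarse structure containing all $E_r=\{(x,y): d(x,y)\le r\}$, $r\ge 0$. Coarse embeddings. A map $f:X\to Y$ between coarse spaces $(X,\mathcal{E})$ and $(Y,\mathcal{F})$ is a coarse embedding if for all $E\in\mathcal{E}$ there is $F\in\mathcal{F}$ such that $(x,x')\in E$ implies $(f(x),f(x'))\in F$, and for all $F\in\mathcal{F}$ there is $E\in\mathcal{E}$ such that $(x,x')\notin E$ implies $(f(x),f(x'))\notin F$. A coarse space coarsely embeds into a Hilbert space if there is a coarse embedding of it into some Hilbert space with the bounded coarse structure of its norm metric. Uniform Roe algebras. For $T\in B(\ell_2(X))$ let $\mathrm{supp}(T)=\{(x,x'):\langle T\delta_x,\delta_{x'}\rangle\ne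 0\}$. The uniform Roe algebra $\mathrm{C}^*_u(X)$ is the norm closure in $B(\ell_2(X))$ of $\{T\in B(\ell_2(X)): \mathrm{supp}(T)\in\mathcal{E}\}$. Isomorphisms of C*-algebras are $*$-isomorphisms. An isomorphism $\Phi\colon \mathrm{C}^*_u(X)\to \mathrm{C}^*_u(Y)$ is rigidly implemented (is a rigid isomorphism) if there is a unitary $U\colon\ell_2(X)\to\ell_2(Y)$ with $\Phi(T)=UTU^*$ for all $T$, $\inf_{x\in X}\sup_{y\in Y}|\langle U\delta_x,\delta_y\rangle|>0$ and $\inf_{y\in Y}\sup_{x\in X}|\langle U^*\delta_y,\delta_x\rangle|>0$. *)

(* Defs.v *)
From HB Require Import structures.
From mathcomp Require Import all_boot all_order all_algebra finmap complex.
From mathcomp Require Import ring lra.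
From mathcomp Require Import all_classical all_reals all_analysis.
From mathcomp Require summability.
Set Implicit Arguments.
Unset Strict Implicit.
Unset Printing Implicit Defensive.
Import Order.TTheory GRing.Theory Num.Theory.
Import numFieldNormedType.Exports.
Import ComplexField.Normc.
Local Open Scope classical_set_scope.
Local Open Scope ring_scope.
Local Open Scope complex_scope.

(* The library equips abstract numeric fields, but not [R[i]], with the
   topology of their norm. *)
HB.instance Definition _ (R : realType) :=
  NormedModule.copy R[i] (R[i] : numClosedFieldType).

HB.mixin Record NormedModule_isInnerProduct (C : numClosedFieldType) V
    & NormedModule C V := {
  inner : V -> V -> C;
  inner_linear : forall v, scalar (inner ^~ v);
  inner_conj : forall u v, inner v u = (inner u v)^*%R;
  inner_norm : forall u, inner u u = `|u| ^+ 2 }.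

#[short(type="innerProductType")]
HB.structure Definition InnerProduct (C : numClosedFieldType) :=
  {V of NormedModule C V & NormedModule_isInnerProduct C V}.

#[short(type="hilbertType")]
HB.structure Definition Hilbert (C : numClosedFieldType) :=
  {V of InnerProduct C V & Complete V}.

HB.factory Record Lmodule_isInnerProduct (C : numClosedFieldType) V
    & GRing.Lmodule C V := {
  inner : V -> V -> C;
  inner_linear : forall v, scalar (inner ^~ v);
  inner_conj : forall u v, inner v u = (inner u v)^*%R;
  inner_ge0 : forall u, 0 <= inner u u;
  inner_eq0 : forall u, inner u u = 0 -> u = 0 }.

HB.builders Context C V & Lmodule_isInnerProduct C V.

Let innerDl u v w : inner (u + v) w = inner u w + inner v w.
Proof. by have := inner_linear w 1 u v; rewrite /= scale1r mul1r. Qed.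

Let inner0l w : inner 0 w = 0.
Proof. by apply: (addrI (inner 0 w)); rewrite -innerDl !addr0. Qed.

Let innerZl a u w : inner (a *: u) w = a * inner u w.
Proof. by have := inner_linear w a u 0; rewrite /= !addr0 inner0l addr0. Qed.

Let innerDr u v w : inner u (v + w) = inner u v + inner u w.
Proof. by rewrite inner_conj innerDl rmorphD/= -!inner_conj. Qed.

Let innerZr a u w : inner u (a *: w) = a^*%R * inner u w.
Proof. by rewrite inner_conj innerZl rmorphM/= -!inner_conj. Qed.

Let cauchy_schwarz u v : `|inner u v| ^+ 2 <= inner u u * inner v v.
Proof.
have [v0|v0] := eqVneq (inner v v) 0.
  by rewrite (inner_eq0 v0) inner_conj inner0l rmorph0 normr0 expr0n/= inner0l mulr0.
have vv : (inner v v)^*%R = inner v v by rewrite -inner_conj.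
have := inner_ge0 (inner v v *: u + (- inner u v) *: v).
rewrite !(innerDl, innerDr, innerZl, innerZr) !rmorphN/= vv (inner_conj u v).
rewrite (_ : _ + _ = inner v v * (inner u u * inner v v - inner u v * (inner u v)^*%R)).
  by rewrite pmulr_rge0 ?subr_ge0 ?lt_def ?v0 ?inner_ge0// -normCK.
by rewrite !mulrDr; set a := inner v v; set b := inner u v; set c := inner u u; ring.
Qed.

Let norm u := sqrtC (inner u u).

Let norm_ge0 u : 0 <= norm u. Proof. by rewrite sqrtC_ge0 inner_ge0. Qed.

Let ler_normD u v : norm (u + v) <= norm u + norm v.
Proof.
rewrite -(@ler_pXn2r _ 2)// ?nnegrE ?addr_ge0 ?norm_ge0//.
rewrite sqrrD !sqrtCK innerDl !innerDr addrA lerD2r -addrA lerD2l (inner_conj u v).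
have -> : inner u v + (inner u v)^*%R = 'Re (inner u v) *+ 2.
  by rewrite ReE -mulr_natr divfK// pnatr_eq0.
rewrite lerMn2r/= (le_trans (leif_Re_Creal _))//.
rewrite -(@ler_pXn2r _ 2)// ?nnegrE ?mulr_ge0 ?norm_ge0//.
by rewrite exprMn !sqrtCK cauchy_schwarz.
Qed.

Let normrZ a u : norm (a *: u) = `|a| * norm u.
Proof.
rewrite /norm innerZl innerZr mulrA -normCK sqrtCM ?nnegrE ?exprn_ge0 ?inner_ge0//.
by rewrite sqrCK.
Qed.

Let normr0_eq0 u : norm u = 0 -> u = 0.
Proof. by move/eqP; rewrite sqrtC_eq0 => /eqP/inner_eq0. Qed.

HB.instance Definition _ := Lmodule_isNormed.Build C V ler_normD normrZ normr0_eq0.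

Let inner_norm u : inner u u = `|u| ^+ 2.
Proof. by rewrite (_ : Num.norm u = norm u)// sqrtCK. Qed.

HB.instance Definition _ := NormedModule_isInnerProduct.Build C V
  inner_linear inner_conj inner_norm.

HB.end.

Section unordered_sum.
Variables (C : numClosedFieldType) (X : choiceType).
Implicit Types z w : X -> C.
Local Notation tot := (@summability.totally X).
Local Notation psum := summability.partial_sum.
Let tot_proper : ProperFilter tot := summability.totally_filter.
#[local] Existing Instance tot_proper.

Lemma unordered_sum_linear (k : C) z w : cvg (psum z @ tot) -> cvg (psum w @ tot) ->
  summability.sum (fun x => k * z x + w x) =
  k * summability.sum z + summability.sum w.
Proof.
move=> cz cw; apply: (@cvg_lim _ _ _ tot); first exact: norm_hausdorff.
rewrite (_ : psum _ = (fun J => k * psum z J + psum w J)).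
  by apply: cvgD => //; apply: cvgM => //; exact: cvg_cst.
by apply/funext => J; rewrite /summability.partial_sum mulr_sumr -big_split.
Qed.

Lemma unordered_sum_conj z : cvg (psum z @ tot) ->
  summability.sum (fun x => (z x)^*%R) = (summability.sum z)^*%R.
Proof.
move=> cz; apply: (@cvg_lim _ _ _ tot); first exact: norm_hausdorff.
rewrite (_ : psum _ = (fun J => (psum z J)^*%R)); last first.
  by apply/funext => J; rewrite /summability.partial_sum rmorph_sum.
move/cvgrPdist_lt : cz => cz; apply/cvgrPdist_lt => e e0.
near=> J; rewrite -rmorphB/= norm_conjC; near: J; exact: cz.
Unshelve. all: by end_near. Qed.

End unordered_sum.

Section ell2_summation.
Variables (R : realType) (X : choiceType).
Implicit Types (u v z : X -> R[i]) (a : X -> R) (J : {fset X}).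
Local Notation tot := (@summability.totally X).
Local Notation psum := summability.partial_sum.
#[local] Existing Instance summability.totally_filter.

Definition square_summable u : bool :=
  (\esum_(x in [set: X]) (normc (u x) ^+ 2)%:E < +oo)%E.

Lemma normr_normc (z : R[i]) : `|z| = (normc z)%:C.
Proof. by []. Qed.

Lemma square_summableP u : reflect
  (exists M : R, forall J, \sum_(x <- J) normc (u x) ^+ 2 <= M)
  (square_summable u).
Proof.
apply: (iffP idP) => [|[M uM]].
- rewrite /square_summable => ufin.
  exists (fine (\esum_(x in [set: X]) (normc (u x) ^+ 2)%:E)) => J.
  rewrite -lee_fin fineK; last first.
    by rewrite ge0_fin_numE// esum_ge0// => x _; rewrite lee_fin sqr_ge0.
  rewrite /esum; apply: ereal_sup_ubound; exists [set` J]; first by split.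
  by rewrite fsbig_finite//= set_fsetK sumEFin.
- rewrite /square_summable (@le_lt_trans _ _ M%:E) ?ltry//.
  apply: ub_ereal_sup => _ [A [Afin _] <-].
  by rewrite fsbig_finite//= sumEFin lee_fin.
Qed.

Definition sup_sum a := sup [set \sum_(x <- J) a x | J in [set: {fset X}]].

Lemma has_sup_sum a (M : R) : (forall J, \sum_(x <- J) a x <= M) ->
  has_sup [set \sum_(x <- J) a x | J in [set: {fset X}]].
Proof.
move=> aM; split; first by exists (\sum_(x <- fset0) a x), fset0.
by exists M => _ [J _ <-].
Qed.

Lemma sup_sum_ub a (M : R) J : (forall J, \sum_(x <- J) a x <= M) ->
  \sum_(x <- J) a x <= sup_sum a.
Proof. by move=> /has_sup_sum [_ ub]; apply: sup_upper_bound; [split; [exists (\sum_(x <- fset0) a x), fset0|]|exists J]. Qed.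

Lemma sup_sum_le a (M : R) : (forall J, \sum_(x <- J) a x <= M) -> sup_sum a <= M.
Proof. by move=> aM; apply: ge_sup; [exists (\sum_(x <- fset0) a x), fset0|move=> _ [J _ <-]]. Qed.

Lemma cvg_sup_sum a (M : R) : (forall x, 0 <= a x) -> (forall J, \sum_(x <- J) a x <= M) ->
  psum a @ tot --> sup_sum a.
Proof.
move=> a0 aM; apply/cvgrPdist_lt => e e0.
have [_ [J _ <-] SJ] := sup_adherent e0 (has_sup_sum aM).
exists J => // J' /= JJ'.
rewrite /summability.partial_sum -(big_seq_fsetE _ _ xpredT)/=.
have JJ'a : \sum_(x <- J) a x <= \sum_(x <- J') a x.
  rewrite [leRHS](big_fsetID _ (mem J))/= (_ : [fset x in J' | x \in J]%fset = J); last first.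
    apply/fsetP => x; rewrite !inE/= andbC.
    by have [/(fsubsetP JJ') ->|] := boolP (x \in J).
  by rewrite lerDl sumr_ge0.
rewrite ger0_norm ?subr_ge0 ?(sup_sum_ub _ aM)// ltrBlDl -ltrBlDr.
exact: lt_le_trans SJ JJ'a.
Qed.

Let cvg_real a (M : R) : (forall J, \sum_(x <- J) `|a x| <= M) ->
  cvg (psum a @ tot).
Proof.
move=> aM; pose b x := `|a x| + a x.
have b0 x : 0 <= b x by have := ler_norm (- a x); rewrite normrN /b; lra.
have bM J : \sum_(x <- J) b x <= M + M.
  rewrite big_split/= lerD// (le_trans _ (aM J))// ler_sum// => x _; exact: ler_norm.
have cb := cvg_sup_sum b0 bM; have ca := cvg_sup_sum (fun=> normr_ge0 _) aM.
apply/cvg_ex; exists (sup_sum b - sup_sum (fun x => `|a x|)).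
rewrite (_ : psum a = psum b \- psum (fun x => `|a x|)); first exact: cvgB.
apply/funext => J; rewrite /summability.partial_sum/= -sumrB.
by apply: eq_bigr => x _; rewrite /b addrC addKr.
Qed.

Lemma gt0_complexP (e : R[i]) : 0 < e -> exists2 d : R, 0 < d & e = d%:C.
Proof. by case: e => d f; rewrite ltcE/= => /andP[/eqP-> d0]; exists d. Qed.

Let cvgC (z : {fset X} -> R[i]) (l : R[i]) :
  (fun J => complex.Re (z J)) @ tot --> complex.Re l ->
  (fun J => complex.Im (z J)) @ tot --> complex.Im l -> z @ tot --> l.
Proof.
move=> /cvgrPdist_lt zr /cvgrPdist_lt zi; apply/cvgrPdist_lt => _ /gt0_complexP[e e0 ->].
have e20 : 0 < e / 2 by rewrite divr_gt0.
near=> J; rewrite [X in `|X|]complexE (le_lt_trans (ler_normD _ _))//.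
rewrite normrM !normr_normc/=.
rewrite !(expr0n, expr1n, add0r, addr0)/= sqrtr1 mul1r !sqrtr_sqr -rmorphD/= ltcR.
by rewrite [e]splitr !raddfB/=; apply: ltrD; near: J; [exact: zr|exact: zi].
Unshelve. all: by end_near. Qed.

Let psumRe z J : complex.Re (psum z J) = psum (fun x => complex.Re (z x)) J.
Proof.
rewrite /summability.partial_sum.
by apply: (big_morph (@complex.Re R)) => [[? ?] [? ?]|].
Qed.

Let psumIm z J : complex.Im (psum z J) = psum (fun x => complex.Im (z x)) J.
Proof.
rewrite /summability.partial_sum.
by apply: (big_morph (@complex.Im R)) => [[? ?] [? ?]|].
Qed.

Lemma normc_Re (z : R[i]) : `|complex.Re z| <= normc z.
Proof. by have := normc_ge_Re z; rewrite normr_normc lecR. Qed.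

Lemma normc_Im (z : R[i]) : `|complex.Im z| <= normc z.
Proof.
case: z => b c /=; rewrite -sqrtr_sqr ler_wsqrtr//.
by rewrite lerDr sqr_ge0.
Qed.

Lemma cvg_complex z (M : R) : (forall J, \sum_(x <- J) normc (z x) <= M) ->
  cvg (psum z @ tot).
Proof.
move=> zM.
have /cvg_ex[/= lr zr] : cvg (psum (fun x => complex.Re (z x)) @ tot).
  by apply: (@cvg_real _ M) => J; rewrite (le_trans _ (zM J))// ler_sum// => x _; exact: normc_Re.
have /cvg_ex[/= li zi] : cvg (psum (fun x => complex.Im (z x)) @ tot).
  by apply: (@cvg_real _ M) => J; rewrite (le_trans _ (zM J))// ler_sum// => x _; exact: normc_Im.
apply/cvg_ex; exists (lr +i* li); apply: cvgC => /=.
- by under eq_fun do rewrite psumRe.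
- by under eq_fun do rewrite psumIm.
Qed.

Let tot_proper : ProperFilter tot := summability.totally_filter.

Lemma unordered_sum_real a (M : R) : (forall x, 0 <= a x) ->
  (forall J, \sum_(x <- J) a x <= M) ->
  summability.sum (fun x => (a x)%:C) = (sup_sum a)%:C.
Proof.
move=> a0 aM; apply: (@cvg_lim _ _ _ tot); first exact: norm_hausdorff.
apply: cvgC => /=.
- by under eq_fun do rewrite psumRe; exact: cvg_sup_sum aM.
- under eq_fun do rewrite psumIm/= /summability.partial_sum big1//.
  exact: cvg_cst.
Qed.

End ell2_summation.
Record ell2 (R : realType) (X : choiceType) := Ell2 {
  ell2_fun :> X -> R[i] ;
  _ : square_summable ell2_fun }.

Section ell2_lmod.
Variables (R : realType) (X : choiceType).
Implicit Types (u v z : X -> R[i]) (a : X -> R) (J : {fset X}).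

Local Notation ell2_pred := (@square_summable R X).

HB.instance Definition _ := [isSub of ell2 R X for @ell2_fun R X].
HB.instance Definition _ := [Choice of ell2 R X by <:].

Let normc_sqD (z w : R[i]) : normc (z + w) ^+ 2 <= (normc z ^+ 2 + normc w ^+ 2) *+ 2.
Proof.
have zw : normc (z + w) <= normc z + normc w by rewrite -lecR -!normr_normc rmorphD/= -!normr_normc ler_normD.
have z0 : 0 <= normc (z + w) by case: (z + w) => ? ?; exact: sqrtr_ge0.
have h : normc (z + w) ^+ 2 <= (normc z + normc w) ^+ 2.
  by rewrite ler_pXn2r// nnegrE (le_trans z0).
rewrite (le_trans h)//; move: (normc z) (normc w) => p q.
rewrite -subr_ge0 (_ : _ - _ = (p - q) ^+ 2) ?sqr_ge0//.
by rewrite mulr2n; ring.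
Qed.

Let ell2_submod_closed : submod_closed ell2_pred.
Proof.
split.
  apply/square_summableP; exists 0 => J.
  by rewrite big1// => x _; rewrite normc0 expr0n.
move=> k u v /square_summableP[M uM] /square_summableP[N vN].
apply/square_summableP; exists ((normc k ^+ 2 * M + N) *+ 2) => J.
rewrite (@le_trans _ _ (\sum_(x <- J) (normc (k * u x) ^+ 2 + normc (v x) ^+ 2) *+ 2))//.
  by apply: ler_sum => x _; exact: normc_sqD.
rewrite sumrMnl lerMn2r/= big_split/= lerD//.
under eq_bigr do rewrite normcM exprMn.
by rewrite -mulr_sumr ler_wpM2l// sqr_ge0.
Qed.

HB.instance Definition _ := GRing.isSubmodClosed.Build R[i] (X -> R[i]) ell2_pred
  ell2_submod_closed.
HB.instance Definition _ := [SubChoice_isSubLmodule of ell2 R X by <:].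

Implicit Types (f g h : ell2 R X).

Lemma ell2P f : square_summable f. Proof. by case: f. Qed.

Definition ell2_inner f g := summability.sum (fun x => f x * (g x)^*%R).

Let normc_ge0 (z : R[i]) : 0 <= normc z.
Proof. by case: z => ? ?; exact: sqrtr_ge0. Qed.

Let normc_conj (z : R[i]) : normc z^*%R = normc z.
Proof. by apply: complexI; rewrite -!normr_normc norm_conjC. Qed.

Lemma cvg_ell2_inner f g :
  cvg (summability.partial_sum (fun x => f x * (g x)^*%R) @ (@summability.totally X)).
Proof.
have /square_summableP[M fM] := ell2P f; have /square_summableP[N gN] := ell2P g.
apply: (@cvg_complex _ _ _ (M + N)) => J.
rewrite (le_trans _ (lerD (fM J) (gN J)))// -big_split/= ler_sum// => x _.
rewrite normcM normc_conj; move: (normc_ge0 (f x)) (normc_ge0 (g x)).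
move: (normc (f x)) (normc (g x)) => p q p0 q0.
have := sqr_ge0 (p - q); nra.
Qed.

Let inner_linear g : scalar (ell2_inner ^~ g).
Proof.
move=> k f h; rewrite /ell2_inner/= -unordered_sum_linear; [|exact: cvg_ell2_inner..].
by congr summability.sum; apply/funext => x; rewrite mulrDl mulrA.
Qed.

Let inner_conj f g : ell2_inner g f = (ell2_inner f g)^*%R.
Proof.
rewrite /ell2_inner -unordered_sum_conj; last exact: cvg_ell2_inner.
by congr summability.sum; apply/funext => x; rewrite rmorphM/= conjCK mulrC.
Qed.

Let inner_sq f : ell2_inner f f = (sup_sum (fun x => normc (f x) ^+ 2))%:C.
Proof.
have /square_summableP[M fM] := ell2P f.
rewrite -(unordered_sum_real (fun x => sqr_ge0 _) fM) /ell2_inner.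
congr summability.sum; apply/funext => x.
by rewrite -normCK normr_normc rmorphXn.
Qed.

Let le_sup_sum f J : \sum_(x <- J) normc (f x) ^+ 2 <= sup_sum (fun x => normc (f x) ^+ 2).
Proof. by have /square_summableP[M fM] := ell2P f; exact: sup_sum_ub fM. Qed.

Let inner_ge0 f : 0 <= ell2_inner f f.
Proof.
by rewrite inner_sq ler0c (le_trans _ (le_sup_sum f fset0))// sumr_ge0// => x _; rewrite sqr_ge0.
Qed.

Let inner_eq0 f : ell2_inner f f = 0 -> f = 0.
Proof.
rewrite inner_sq => -[S0]; apply/val_inj/funext => x /=.
have := le_sup_sum f [fset x]%fset; rewrite S0 big_seq_fset1 => fx.
apply: eq0_normc; apply/eqP; rewrite -sqrf_eq0; apply/eqP/le_anti.
by rewrite fx sqr_ge0.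
Qed.

HB.instance Definition _ := Lmodule_isInnerProduct.Build R[i] (ell2 R X)
  inner_linear inner_conj inner_ge0 inner_eq0.

Lemma ell2_norm_leP f (r : R) : 0 <= r ->
  `|f| <= r%:C <-> forall J, \sum_(x <- J) normc (f x) ^+ 2 <= r ^+ 2.
Proof.
move=> r0.
have -> : (`|f| <= r%:C) = (sup_sum (fun x => normc (f x) ^+ 2) <= r ^+ 2).
  rewrite -[RHS]lecR rmorphXn/= -inner_sq -[ell2_inner f f]/(inner f f) inner_norm.
  by rewrite ler_pXn2r// nnegrE// ler0c.
split => [fr J|]; first exact: le_trans (le_sup_sum f J) fr.
exact: sup_sum_le.
Qed.

Let coord_le f x : (normc (f x))%:C <= `|f|.
Proof.
have [r r0 fr] : exists2 r : R, 0 <= r & `|f| = r%:C.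
  by have := normr_ge0 f; case: `|f| => r q; rewrite lecE/= => /andP[/eqP-> r0]; exists r.
have := (ell2_norm_leP f r0).1; rewrite fr lexx => /(_ isT [fset x]%fset).
by rewrite big_seq_fset1 lecR ler_pXn2r ?nnegrE.
Qed.

Let ell2_cauchy_coord (F : set_system (ell2 R X)) : ProperFilter F -> cauchy F ->
  exists l : X -> R[i], forall x (e : R), 0 < e ->
    \forall f \near F, normc ((f : ell2 R X) x - l x) <= e.
Proof.
move=> FF /cauchyP Fc.
have real_lim (p : R[i] -> R) : (forall y z : R[i], p (y - z) = p y - p z) ->
    (forall z : R[i], `|p z| <= normc z) -> forall x,
    exists r : R, forall e, 0 < e -> \forall f \near F, `|p ((f : ell2 R X) x) - r| <= e.
  move=> pB p_le x.
  have /cauchy_cvg/cvg_ex[/= r /cvgrPdist_le Fr] :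
      cauchy ((fun f : ell2 R X => p (f x)) @ F).
    apply/cauchyP => e e0; have e0' : 0 < e%:C by rewrite ltcR.
    have [f Ff] := Fc _ e0'; exists (p (f x)).
    suff : F [set h : ell2 R X | ball (p (f x)) e (p (h x))] by [].
    apply: filterS Ff => h; rewrite /= -!ball_normE/= => fh.
    rewrite -pB (le_lt_trans (p_le _))//.
    rewrite -ltcR; apply: le_lt_trans fh.
    exact: coord_le (f - h) x.
  by exists r => e e0; apply: filterS (Fr e e0) => f; rewrite distrC.
have ReB (y z : R[i]) : complex.Re (y - z) = complex.Re y - complex.Re z.
  by case: y z => ? ? [? ?].
have ImB (y z : R[i]) : complex.Im (y - z) = complex.Im y - complex.Im z.
  by case: y z => ? ? [? ?].
have /choice[lr lrP] := real_lim (@complex.Re R) ReB (@normc_Re R).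
have /choice[li liP] := real_lim (@complex.Im R) ImB (@normc_Im R).
exists (fun x => lr x +i* li x) => x e e0.
have e20 : 0 < e / 2 by rewrite divr_gt0.
near=> f.
have fr : `|complex.Re (f x) - lr x| <= e / 2 by near: f; exact: lrP.
have fi : `|complex.Im (f x) - li x| <= e / 2 by near: f; exact: liP.
case: (f x) fr fi => p q /= fr fi.
rewrite -(ger0_norm (ltW e0)) -sqrtr_sqr ler_wsqrtr//.
move: fr fi; rewrite !ler_norml => /andP[? ?] /andP[? ?]; nra.
Unshelve. all: by end_near. Qed.

Let ell2_complete (F : set_system (ell2 R X)) : ProperFilter F -> cauchy F -> cvg F.
Proof.
move=> FF Fc; have [l Fl] := ell2_cauchy_coord FF Fc.
have near_l (J : seq X) (d : R) : 0 < d ->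
    \forall f \near F, forall x, x \in J -> normc ((f : ell2 R X) x - l x) <= d.
  move=> d0; elim: J => [|x J IH].
    by apply: nearW => f x.
  near=> f => y; rewrite inE => /orP[/eqP->|]; first by near: f; exact: Fl.
  by move: y; near: f.
have key (e : R) (A : set (ell2 R X)) (g : ell2 R X) : 0 < e -> F A ->
    (forall f, A f -> `|g - f| <= e%:C) ->
    forall J, \sum_(x <- J) normc (g x - l x) ^+ 2 <= (2 * e) ^+ 2.
  move=> e0 FA Ag J.
  have aux (m : R) : 0 <= m -> m <= (1 + m) ^+ 2 by move=> m0; nra.
  pose n : R := (size J)%:R; pose d := e / (1 + n).
  have n0 : 0 <= n by rewrite ler0n.
  have d0 : 0 < d by rewrite divr_gt0// ltr_pwDl.
  have [f [Af fl]] := filter_ex (filterI FA (near_l J d d0)).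
  have /(ell2_norm_leP _ (ltW e0))/(_ J) gf := Ag f Af.
  rewrite (@le_trans _ _ (\sum_(x <- J) (normc ((g - f) x) ^+ 2 + d ^+ 2) *+ 2))//.
    rewrite big_seq [leRHS]big_seq; apply: ler_sum => x xJ.
    have -> : g x - l x = (g - f) x + (f x - l x) by rewrite [(g - f) x]/(g x - f x) addrA subrK.
    rewrite (le_trans (normc_sqD _ _))// lerMn2r/= lerD2l ler_pXn2r// ?nnegrE//; [exact: fl|exact: ltW].
  rewrite sumrMnl big_split/=.
  rewrite (_ : \sum_(x <- J) d ^+ 2 = n * d ^+ 2); last first.
    by rewrite big_const_seq count_predT iter_addr_0 mulr_natl.
  have nd : n * d ^+ 2 <= e ^+ 2.
    rewrite /d expr_div_n mulrA ler_pdivrMr ?exprn_gt0 ?ltr_pwDl//.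
    rewrite [leLHS]mulrC ler_wpM2l ?sqr_ge0// aux//.
  have h := lerD gf nd; rewrite (@le_trans _ _ ((e ^+ 2 + e ^+ 2) *+ 2))//.
    by rewrite lerMn2r.
  by rewrite -mulr2n -mulrnA exprMn -natrX mulr_natl.
have /cauchyP Fc' := Fc.
have ball_le (e : R) (f g : ell2 R X) : ball f e%:C g -> `|f - g| <= e%:C.
  by rewrite -ball_normE => /ltW.
have [f0 Ff0] := Fc' 1%:C ltr01.
have Dsq : square_summable (fun x => f0 x - l x).
  apply/square_summableP; eexists; apply: (key 1 _ f0 ltr01 Ff0).
  exact: ball_le.
pose L : ell2 R X := f0 - Ell2 Dsq.
have LE x : L x = l x by exact: subKr.
apply/cvg_ex; exists L; apply/cvgrPdist_le => eps eps0.
have [e e0 ->] : exists2 e : R, 0 < e & eps = (4 * e)%:C.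
  have [d d0 ->] := gt0_complexP eps0; exists (d / 4); first by rewrite divr_gt0.
  by rewrite mulrC divfK.
have e0' : 0 < e%:C by rewrite ltcR.
have [f Ff] := Fc' _ e0'.
have fL : `|f - L| <= (2 * e)%:C.
  apply/ell2_norm_leP; first by rewrite mulr_ge0// ltW.
  move=> J; have := key e _ f e0 Ff (fun g => @ball_le e f g) J.
  by under eq_bigr do rewrite -LE.
apply: filterS Ff => g /ball_le fg.
rewrite distrC -(subrKA f) (le_trans (ler_normD _ _))//.
rewrite [X in X + _]distrC (le_trans (lerD fg fL))// -rmorphD/= lecR; lra.
Unshelve. all: by end_near. Qed.

HB.instance Definition _ := Uniform_isComplete.Build (ell2 R X) ell2_complete.
End ell2_lmod.

Section delta.
Variables (R : realType) (X : choiceType).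

Let delta_subproof (x : X) :
  square_summable (fun y => (y == x)%:R : R[i]).
Proof.
apply/square_summableP; exists 1 => J.
have [xJ|xJ] := boolP (x \in J).
  rewrite (big_fsetD1 x)//= eqxx normc1 expr1n big_seq big1 ?addr0// => y.
  by rewrite !inE => /andP[/negPf-> _]; rewrite normc0 expr0n.
rewrite big_seq big1 ?ler01// => y yJ.
by have [yx|_] := eqVneq y x; [rewrite -yx yJ in xJ|rewrite normc0 expr0n].
Qed.

Definition delta (x : X) : ell2 R X := Ell2 (delta_subproof x).

Lemma inner_delta (u : ell2 R X) (x : X) : inner u (delta x) = u x.
Proof.
have tot_proper := @summability.totally_filter X.
rewrite -[LHS]/(ell2_inner u (delta x)).
apply: (@cvg_lim _ _ _ (@summability.totally X)); first exact: norm_hausdorff.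
apply: cvg_near_cst; exists [fset x]%fset => // J /= xJ.
rewrite /summability.partial_sum.
rewrite -(big_seq_fsetE _ _ xpredT (fun y => u y * ((y == x)%:R : R[i])^*%R))/=.
rewrite (big_fsetD1 x)/=; last by apply: (fsubsetP xJ); rewrite inE.
rewrite eqxx rmorph1 mulr1 big_seq big1 ?addr0// => y.
by rewrite !inE => /andP[/negPf-> _]; rewrite rmorph0 mulr0.
Qed.

End delta.

Section operators.
Variable R : realType.
Implicit Types H K : hilbertType R[i].

Definition opnorm H K (T : H -> K) : \bar R := ereal_inf
  [set M%:E | M in [set M | 0 <= M /\ forall u, `|T u| <= M%:C * `|u|]].

Definition bounded_operator H K : set (H -> K) :=
  [set T | linear T /\ (opnorm T < +oo)%E].

Definition norm_closure H K (A : set (H -> K)) : set (H -> K) :=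
  [set T | bounded_operator T /\
     forall e : R, 0 < e -> exists2 S, A S & (opnorm (T - S)%R < e%:E)%E].

(* [S] is the Hilbert space adjoint of [T]. *)
Definition is_adjoint H K (T : H -> K) (S : K -> H) : Prop :=
  forall u v, inner (T u) v = inner u (S v).

Definition is_unitary H K (U : H -> K) (Ustar : K -> H) : Prop :=
  [/\ bounded_operator U, is_adjoint U Ustar,
      Ustar \o U = id & U \o Ustar = id].

(* Only the restriction of [Phi] to [A] matters. The adjoint of an operator
   is unique, so the last clause says that [Phi] preserves adjoints. *)
Definition star_isomorphism H K (A : set (H -> H)) (B : set (K -> K))
    (Phi : (H -> H) -> (K -> K)) : Prop :=
  [/\ set_bij A B Phi,
      forall (a : R[i]) S T, A S -> A T -> Phi (a *: S + T) = a *: Phi S + Phi T,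
      forall S T, A S -> A T -> Phi (S \o T) = Phi S \o Phi T &
      forall S T, A S -> A T -> is_adjoint S T -> is_adjoint (Phi S) (Phi T)].

End operators.

Section coarse.

Definition coarse_structure (X : Type) (E : set (set (X * X))) : Prop :=
  [/\ E diagonal,
      forall A B, B `<=` A -> E A -> E B,
      forall A, E A -> E (A^-1)%relation,
      forall A B, E A -> E B -> E (A `|` B) &
      forall A B, E A -> E B -> E (A \; B)%relation].

Definition uniformly_locally_finite (X : Type) (E : set (set (X * X))) : Prop :=
  forall A, E A -> exists n : nat, forall x, ([set y | A (x, y)] #<= `I_n)%card.

Definition bounded_coarse_structure (K : numDomainType) (X : Type)
    (d : X -> X -> K) : set (set (X * X)) :=
  smallest (@coarse_structure X)
    [set [set p | d p.1 p.2 <= r] | r in [set r : K | 0 <= r]].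

Definition coarse_embedding (X Y : Type) (E : set (set (X * X)))
    (F : set (set (Y * Y))) (f : X -> Y) : Prop :=
  (forall A, E A -> exists2 B, F B &
     forall x x', A (x, x') -> B (f x, f x')) /\
  (forall B, F B -> exists2 A, E A &
     forall x x', ~ A (x, x') -> ~ B (f x, f x')).

(* The norm of a complex Hilbert space takes its values in [R[i]], where
   [0 <= r] means that [r] is a nonnegative real. *)
Definition coarsely_embeds_into_hilbert (R : realType) (X : Type)
    (E : set (set (X * X))) : Prop :=
  exists (H : hilbertType R[i]) (f : X -> H),
    coarse_embedding E (bounded_coarse_structure (fun u v : H => `|u - v|)) f.

End coarse.

Section uniform_roe.
Variable R : realType.

Definition supp (X : choiceType) (T : ell2 R X -> ell2 R X) : set (X * X) :=
  [set p | inner (T (delta R p.1)) (delta R p.2) != 0].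

Definition uniform_roe (X : choiceType) (E : set (set (X * X))) :
    set (ell2 R X -> ell2 R X) :=
  norm_closure [set T | bounded_operator T /\ E (supp T)].

(* The infima and suprema are taken in [\bar R]: the infimum over an empty set
   is [+oo], so that the two lower bounds hold when the spaces are empty. *)
Definition rigidly_implemented (X Y : choiceType) (A : set (ell2 R X -> ell2 R X))
    (Phi : (ell2 R X -> ell2 R X) -> (ell2 R Y -> ell2 R Y)) : Prop :=
  exists (U : ell2 R X -> ell2 R Y) (Ustar : ell2 R Y -> ell2 R X),
    [/\ is_unitary U Ustar,
        forall T, A T -> Phi T = U \o T \o Ustar,
        (0 < ereal_inf [set ereal_sup
           [set (normc (inner (U (delta R x)) (delta R y)))%:E | y in [set: Y]]
           | x in [set: X]])%E &
        (0 < ereal_inf [set ereal_sup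
           [set (normc (inner (Ustar (delta R y)) (delta R x)))%:E | x in [set: X]]
           | y in [set: Y]])%E].

End uniform_roe.

Arguments uniform_roe R {X} E.

(* Main.v *)
(* A fixed rank one operator shows that the isomorphism has the form [Phi T = U T U*]
   with [U] unitary. It remains to bound the largest coefficient of the unit
   vectors [xi_x = U delta_x] from below; applying the bound to [U*] as well gives
   both infima. If there is no bound, a gliding hump gives points [x_n] whose
   vectors [xi_n] are flatter and flatter and almost supported on disjoint finite
   sets [K_n]. The image [Q] of the diagonal projection onto the [x_n] lies within
   a small [e] of a banded operator [S], and the compression of [Q] to [K_n] is
   close to the rank one projection onto [xi_n]. So a single banded [S]
   approximates all these rank one projections on their [K_n].
   Now multiply matrix entries by a Gaussian kernel [k = exp (- t |f y - f y'|^2)],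
   with [f] the embedding into a Hilbert space. This does not increase norms, as [k]
   is positive definite with diagonal 1; it hardly changes [S] when [t] is small;
   and it makes the projection onto [xi_n] small at [xi_n], because [k] is small
   far from the diagonal and [xi_n] has little mass on each ball. This contradicts
   [<S xi_n, xi_n>] being close to 1. *)
Require Import Defs.
From mathcomp Require Import all_boot all_order all_algebra finmap complex.
From mathcomp Require Import ring lra.
From mathcomp Require Import all_classical all_reals all_analysis.
Set Implicit Arguments.
Unset Strict Implicit.
Unset Printing Implicit Defensive.
Import Order.TTheory GRing.Theory Num.Theory.
Import numFieldNormedType.Exports.
Import ComplexField.Normc.
Local Open Scope classical_set_scope.
Local Open Scope ring_scope.
Local Open Scope complex_scope.

(** * Inner product spaces over the complex numbers *)

Section modulus.
Variable R : realType.
Implicit Types z w : R[i].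

Lemma normc_ge0 z : 0 <= normc z.
Proof. by case: z => ? ?; exact: sqrtr_ge0. Qed.

Lemma normc_conj z : normc z^*%R = normc z.
Proof. by apply: complexI; rewrite -!normr_normc norm_conjC. Qed.

Lemma conj_real (r : R) : (r%:C)^*%R = r%:C :> R[i].
Proof. exact: conjc_real. Qed.

Lemma normcD z w : normc (z + w) <= normc z + normc w.
Proof. exact: le_normcD. Qed.

Lemma normc_real (r : R) : normc r%:C = `|r|.
Proof. by rewrite /= expr0n addr0 sqrtr_sqr. Qed.

Lemma sqr_normc z : z * z^*%R = (normc z ^+ 2)%:C.
Proof. by rewrite -normCK normr_normc rmorphXn. Qed.

Lemma normc_sum (I : Type) (s : seq I) (P : pred I) (f : I -> R[i]) :
  normc (\sum_(i <- s | P i) f i) <= \sum_(i <- s | P i) normc (f i).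
Proof.
elim/big_rec2: _ => [|i y x _ le_xy]; first by rewrite normc0.
by rewrite (le_trans (normcD _ _))// lerD2l.
Qed.

End modulus.

Section inner_product.
Variables (R : realType) (H : innerProductType R[i]).
Implicit Types u v w : H.

Lemma innerDl u v w : inner (u + v) w = inner u w + inner v w.
Proof. by have := inner_linear w 1 u v; rewrite /= scale1r mul1r. Qed.

Lemma inner0l w : inner 0 w = 0.
Proof. by apply: (addrI (inner 0 w)); rewrite -innerDl !addr0. Qed.

Lemma innerZl a u w : inner (a *: u) w = a * inner u w.
Proof. by have := inner_linear w a u 0; rewrite /= !addr0 inner0l addr0. Qed.

Lemma innerNl u w : inner (- u) w = - inner u w.
Proof. by rewrite -scaleN1r innerZl mulN1r. Qed.

Lemma innerBl u v w : inner (u - v) w = inner u w - inner v w.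
Proof. by rewrite innerDl innerNl. Qed.

Lemma inner0r w : inner w 0 = 0.
Proof. by rewrite inner_conj inner0l rmorph0. Qed.

Lemma innerDr u v w : inner u (v + w) = inner u v + inner u w.
Proof. by rewrite inner_conj innerDl rmorphD/= -!inner_conj. Qed.

Lemma innerZr a u w : inner u (a *: w) = a^*%R * inner u w.
Proof. by rewrite inner_conj innerZl rmorphM/= -!inner_conj. Qed.

Lemma innerNr u w : inner u (- w) = - inner u w.
Proof. by rewrite inner_conj innerNl rmorphN/= -inner_conj. Qed.

Lemma innerBr u v w : inner u (v - w) = inner u v - inner u w.
Proof. by rewrite innerDr innerNr. Qed.

Lemma inner_suml (I : Type) (s : seq I) (f : I -> H) w :
  inner (\sum_(i <- s) f i) w = \sum_(i <- s) inner (f i) w.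
Proof. by apply: (big_morph (inner ^~ w)) => [u v|]; rewrite ?innerDl ?inner0l. Qed.

Lemma inner_sumr (I : Type) (s : seq I) (f : I -> H) w :
  inner w (\sum_(i <- s) f i) = \sum_(i <- s) inner w (f i).
Proof. by apply: (big_morph (inner w)) => [u v|]; rewrite ?innerDr ?inner0r. Qed.

(* The norm of [H] takes its values in [R[i]]. *)
Definition rnorm u : R := complex.Re `|u|.

Lemma rnormE u : `|u| = (rnorm u)%:C.
Proof.
have := normr_ge0 u; rewrite /rnorm; case: `|u| => r q.
by rewrite lecE/= => /andP[/eqP->].
Qed.

Lemma rnorm_ge0 u : 0 <= rnorm u.
Proof. by rewrite -ler0c -rnormE. Qed.

Lemma rnorm_le u (r : R) : (`|u| <= r%:C) = (rnorm u <= r).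
Proof. by rewrite rnormE lecR. Qed.

Lemma rnormD u v : rnorm (u + v) <= rnorm u + rnorm v.
Proof. by rewrite -rnorm_le rmorphD/= -!rnormE ler_normD. Qed.

Lemma rnormB u v : rnorm (u - v) = rnorm (v - u).
Proof. by rewrite /rnorm distrC. Qed.

Lemma rnormZ a u : rnorm (a *: u) = normc a * rnorm u.
Proof. by apply: complexI; rewrite -rnormE normrZ normr_normc rnormE rmorphM. Qed.

Lemma rnorm0 : rnorm 0 = 0.
Proof. by rewrite /rnorm normr0. Qed.

Lemma rnorm0_eq0 u : rnorm u = 0 -> u = 0.
Proof. by move=> u0; apply/eqP; rewrite -normr_eq0 rnormE u0. Qed.

Lemma inner_self u : inner u u = (rnorm u ^+ 2)%:C.
Proof. by rewrite inner_norm rnormE rmorphXn. Qed.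

Lemma cauchy_schwarz u v : normc (inner u v) <= rnorm u * rnorm v.
Proof.
have [v0|v0] := eqVneq (rnorm v) 0.
  by rewrite v0 (rnorm0_eq0 v0) inner0r normc0 mulr0.
have vv : inner v v != 0.
  by rewrite inner_self (inj_eq (@complexI R) _ 0) expf_neq0.
rewrite -(@ler_pXn2r _ 2)// ?nnegrE ?mulr_ge0 ?rnorm_ge0 ?normc_ge0//.
pose w := u - (inner u v / inner v v) *: v.
have : 0 <= inner w w by rewrite inner_self ler0c sqr_ge0.
have wv : inner w v = 0 by rewrite innerBl innerZl divfK// subrr.
rewrite {2}/w innerBr innerZr wv mulr0 subr0 /w innerBl innerZl.
rewrite -mulrAC (inner_conj u v) sqr_normc !inner_self.
rewrite -fmorphV/= -rmorphM/= -rmorphB/= ler0c subr_ge0.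
by rewrite ler_pdivrMr ?exprMn// exprn_gt0// lt_def v0 rnorm_ge0.
Qed.

Definition rinner u v : R := complex.Re (inner u v).

Lemma rnormB_sqr u v :
  rnorm (u - v) ^+ 2 = rnorm u ^+ 2 + rnorm v ^+ 2 - 2 * rinner u v.
Proof.
have self w : rnorm w ^+ 2 = rinner w w by rewrite /rinner inner_self.
have sym : rinner v u = rinner u v.
  by rewrite /rinner inner_conj; case: (inner u v).
rewrite !self {1}/rinner innerBl !innerBr.
rewrite !raddfB/= -!/(rinner _ _) sym; ring.
Qed.

End inner_product.

(** * Operators on square-summable families *)

Section linear_maps.
Variables (R : realType) (H K : hilbertType R[i]) (T : H -> K).
Hypothesis linT : linear T.

Lemma lin_add u v : T (u + v) = T u + T v.
Proof. by have := linT 1 u v; rewrite !scale1r. Qed.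

Lemma lin0 : T 0 = 0.
Proof. by apply: (addrI (T 0)); rewrite -lin_add !addr0. Qed.

Lemma lin_scale a u : T (a *: u) = a *: T u.
Proof. by have := linT a u 0; rewrite lin0 !addr0. Qed.

Lemma lin_sub u v : T (u - v) = T u - T v.
Proof. by rewrite lin_add -scaleN1r lin_scale scaleN1r. Qed.

Lemma lin_sum (I : Type) (s : seq I) (f : I -> H) :
  T (\sum_(i <- s) f i) = \sum_(i <- s) T (f i).
Proof. by apply: (big_morph T) => [u v|]; rewrite ?lin_add ?lin0. Qed.

End linear_maps.

Section bounded_operators.
Variables (R : realType) (H K : hilbertType R[i]).
Implicit Types T : H -> K.

Lemma opnorm_ltP T (e : R) : (opnorm T < e%:E)%E <->
  exists M : R, [/\ 0 <= M, M < e & forall u, rnorm (T u) <= M * rnorm u].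
Proof.
split=> [/ereal_inf_lt[_ [M [M0 TM] <-]]|[M [M0 Me TM]]].
  rewrite lte_fin => Me; exists M; split=> // u.
  by rewrite -rnorm_le rmorphM/= -rnormE.
apply: le_lt_trans (_ : M%:E < _)%E; last by rewrite lte_fin.
apply: ereal_inf_lbound; exists M => //; split=> // u.
by rewrite !rnormE -rmorphM lecR.
Qed.

Lemma bounded_operatorP T : bounded_operator T <->
  linear T /\ exists2 M : R, 0 <= M & forall u, rnorm (T u) <= M * rnorm u.
Proof.
split=> [[linT /ereal_inf_lt[_ [M [M0 TM] <-] _]]|[linT [M M0 TM]]]; split=> //.
  by exists M => // u; rewrite -rnorm_le rmorphM/= -rnormE.
apply: lt_trans (_ : ((M + 1)%:E < _)%E); last exact: ltry.
by apply/opnorm_ltP; exists M; split=> //; rewrite ltrDl.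
Qed.

Lemma norm_closure_sub (A : set (H -> K)) : A `<=` @bounded_operator R H K ->
  A `<=` norm_closure A.
Proof.
move=> Ab T AT; split=> [|e e0]; first exact: Ab.
exists T => //; apply/opnorm_ltP; exists 0; split=> // u.
by rewrite mul0r [(T - T) u]subrr rnorm0.
Qed.

End bounded_operators.

Section ell2_geometry.
Variables (R : realType) (X : choiceType).
Implicit Types (f g u v w : ell2 R X) (J : {fset X}) (A : set X).

Lemma ell2_ext f g : f =1 g -> f = g.
Proof. by move=> fg; apply/val_inj/funext. Qed.

Lemma ell2_add f g x : (f + g) x = f x + g x.
Proof. by []. Qed.

Lemma ell2_sub f g x : (f - g) x = f x - g x.
Proof. by []. Qed.

Lemma ell2_scale (a : R[i]) f x : (a *: f) x = a * f x.
Proof. by []. Qed.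

Lemma inner_delta_l x u : inner (delta R x) u = (u x)^*%R.
Proof. by rewrite inner_conj inner_delta. Qed.

Lemma rnorm_delta (x : X) : rnorm (delta R x) = 1.
Proof.
apply/eqP; rewrite -(@eqrXn2 _ 2)// ?rnorm_ge0// expr1n; apply/eqP/complexI.
by rewrite -inner_self inner_delta /= eqxx.
Qed.

Lemma rnorm_leP f (r : R) : 0 <= r ->
  rnorm f <= r <-> forall J, \sum_(x <- J) normc (f x) ^+ 2 <= r ^+ 2.
Proof. by move=> r0; rewrite -rnorm_le; exact: ell2_norm_leP. Qed.

Lemma fsum_le_rnorm f J : \sum_(x <- J) normc (f x) ^+ 2 <= rnorm f ^+ 2.
Proof. by move: J; apply/rnorm_leP => //; exact: rnorm_ge0. Qed.

Lemma coord_le_rnorm f x : normc (f x) <= rnorm f.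
Proof.
rewrite -(@ler_pXn2r _ 2)// ?nnegrE ?normc_ge0 ?rnorm_ge0//.
by have := fsum_le_rnorm f [fset x]%fset; rewrite big_seq_fset1.
Qed.

Lemma rnorm_mono f g : (forall x, normc (f x) <= normc (g x)) -> rnorm f <= rnorm g.
Proof.
move=> fg; apply/rnorm_leP => [|J]; first exact: rnorm_ge0.
apply: le_trans (fsum_le_rnorm g J); apply: ler_sum => x _.
by rewrite ler_pXn2r// nnegrE normc_ge0.
Qed.

Fact restr_subproof A f : square_summable (fun x => if x \in A then f x else 0).
Proof.
have /square_summableP[M fM] := ell2P f; apply/square_summableP; exists M => J.
apply: le_trans (fM J); apply: ler_sum => x _.
by case: ifP => // _; rewrite normc0 expr0n/= sqr_ge0.
Qed.

Definition restr A f : ell2 R X := Ell2 (restr_subproof A f).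

Lemma restrE A f x : restr A f x = if x \in A then f x else 0.
Proof. by []. Qed.

Lemma restr_linear A : linear (restr A).
Proof.
move=> a u v; apply: ell2_ext => x; rewrite ell2_add ell2_scale !restrE.
by case: ifP; rewrite ?mulr0 ?addr0.
Qed.

Lemma rnorm_restr A f : rnorm (restr A f) <= rnorm f.
Proof.
by apply: rnorm_mono => x; rewrite restrE; case: ifP => // _; rewrite normc0 normc_ge0.
Qed.

Lemma restr_bounded A : bounded_operator (restr A).
Proof.
apply/bounded_operatorP; split; first exact: restr_linear.
by exists 1 => // u; rewrite mul1r rnorm_restr.
Qed.

Lemma inner_restr A u v : inner (restr A u) v = inner u (restr A v).
Proof.
rewrite -[LHS]/(ell2_inner _ _) -[RHS]/(ell2_inner _ _) /ell2_inner.
congr summability.sum; apply/funext => x; rewrite !restrE.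
by case: ifP; rewrite ?mul0r ?rmorph0 ?mulr0.
Qed.

Lemma restr_idem A f : restr A (restr A f) = restr A f.
Proof. by apply: ell2_ext => x; rewrite !restrE; case: (x \in A). Qed.

Lemma restr_pythagoras A f :
  rnorm f ^+ 2 = rnorm (restr A f) ^+ 2 + rnorm (f - restr A f) ^+ 2.
Proof.
apply: complexI; rewrite rmorphD/= -!inner_self innerBl !innerBr.
by rewrite -!inner_restr restr_idem subrr subr0 addrC subrK.
Qed.

(** If every finite truncation stayed more than [e] away, Pythagoras would bound all finite sums of
    squares by [rnorm f ^+ 2 - e ^+ 2], and so their supremum [rnorm f ^+ 2] as well. *)
Lemma finite_approx f (e : R) : 0 < e ->
  exists J, rnorm (f - restr [set` J] f) <= e.
Proof.
move=> e0; apply: contrapT => /forallNP far.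
have gap J : \sum_(x <- J) normc (f x) ^+ 2 <= rnorm f ^+ 2 - e ^+ 2.
  have /negP := far J; rewrite -ltNge => /ltW.
  rewrite -(@ler_pXn2r _ 2)// ?nnegrE ?rnorm_ge0 ?(ltW e0)//.
  move=> eJ; have := restr_pythagoras [set` J] f.
  have : \sum_(x <- J) normc (f x) ^+ 2 <= rnorm (restr [set` J] f) ^+ 2.
    apply: le_trans (fsum_le_rnorm _ J); rewrite big_seq [leRHS]big_seq.
    by apply: ler_sum => x xJ; rewrite restrE mem_set.
  lra.
have s0 : 0 <= rnorm f ^+ 2 - e ^+ 2.
  by apply: le_trans (gap fset0); rewrite big_seq_fset0.
have : rnorm f <= Num.sqrt (rnorm f ^+ 2 - e ^+ 2).
  by apply/rnorm_leP => [|J]; rewrite ?sqrtr_ge0// sqr_sqrtr.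
rewrite -(@ler_pXn2r _ 2)// ?nnegrE ?rnorm_ge0 ?sqrtr_ge0// sqr_sqrtr//.
have : 0 < e ^+ 2 by rewrite exprn_gt0.
lra.
Qed.

Definition fvec J (b : X -> R[i]) : ell2 R X := \sum_(x <- J) b x *: delta R x.

Lemma fvecE J b x : fvec J b x = if x \in J then b x else 0.
Proof.
rewrite -inner_delta /fvec inner_suml.
have coord y : inner (b y *: delta R y) (delta R x) = if x == y then b y else 0.
  by rewrite inner_delta ell2_scale/=; case: eqP; rewrite ?mulr1 ?mulr0.
under eq_bigr do rewrite coord.
case: ifPn => xJ; last first.
  by rewrite big_seq big1// => y yJ; case: eqP => // xy; rewrite xy yJ in xJ.
rewrite (big_fsetD1 x)//= eqxx big_seq big1 ?addr0// => y.
by rewrite !inE eq_sym => /andP[/negPf-> _].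
Qed.

Lemma restr_fvec J f : restr [set` J] f = fvec J f.
Proof.
apply: ell2_ext => x; rewrite fvecE restrE; congr (if _ then _ else _).
by apply/idP/idP; rewrite inE.
Qed.

Lemma inner_fvec J b w : inner (fvec J b) w = \sum_(x <- J) b x * (w x)^*%R.
Proof.
by rewrite inner_suml; apply: eq_bigr => x _; rewrite innerZl inner_delta_l.
Qed.

Lemma rnorm_fvec J b : rnorm (fvec J b) ^+ 2 = \sum_(x <- J) normc (b x) ^+ 2.
Proof.
apply: complexI; rewrite -inner_self inner_fvec rmorph_sum/= big_seq [RHS]big_seq.
by apply: eq_bigr => x xJ; rewrite fvecE xJ sqr_normc.
Qed.

End ell2_geometry.

(** * Rank one operators and diagonal projections in the Roe algebra *)

Section rank_one.
Variables (R : realType) (X : choiceType).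
Implicit Types u v w : ell2 R X.

Definition rank_one u v w : ell2 R X := inner w v *: u.

Lemma rank_one_bounded u v : bounded_operator (rank_one u v).
Proof.
apply/bounded_operatorP; split=> [a w z|].
  by rewrite /rank_one innerDl innerZl scalerDl scalerA.
exists (rnorm v * rnorm u) => [|w]; first by rewrite mulr_ge0 ?rnorm_ge0.
rewrite rnormZ mulrAC ler_wpM2r ?rnorm_ge0//.
by rewrite mulrC cauchy_schwarz.
Qed.

Lemma rank_one_adjoint u v : is_adjoint (rank_one u v) (rank_one v u).
Proof. by move=> w z; rewrite innerZl innerZr -inner_conj mulrC. Qed.

Lemma rank_one_comp (T : ell2 R X -> ell2 R X) u v : linear T ->
  T \o rank_one u v = rank_one (T u) v.
Proof. by move=> linT; apply/funext => w; rewrite /= lin_scale. Qed.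

Variable E : set (set (X * X)).
Hypothesis hE : coarse_structure E.

Lemma restr_uniform_roe (A : set X) : uniform_roe R E (restr A).
Proof.
apply: norm_closure_sub => [T []//|]; split; first exact: restr_bounded.
have [Ediag Esub _ _ _] := hE; apply: Esub Ediag => -[x x'] /=.
rewrite /supp/= inner_delta restrE; case: ifP => [_|_ /eqP//].
by have [->//|/negPf x'x] := eqVneq x' x; rewrite /= x'x => /eqP.
Qed.

Hypothesis conE : forall x x', exists2 A, E A & A (x, x').

Lemma finite_entourage (s : seq (X * X)) : E [set` s].
Proof.
have [Ediag Esub _ EU _] := hE.
elim: s => [|[x x'] s IHs]; first by apply: Esub Ediag => p.
have [A EA Axx'] := conE x x'.
apply: Esub (EU _ _ EA IHs) => p /=.
by rewrite inE => /orP[/eqP->|ps]; [left|right].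
Qed.

(** Truncating both vectors to finite sets approximates the operator in norm. The truncated operator
    has finite support, and by [conE] finite sets of pairs are entourages. *)
Lemma rank_one_uniform_roe u v : uniform_roe R E (rank_one u v).
Proof.
split=> [|e e0]; first exact: rank_one_bounded.
(* With truncation errors [e / 2 / n], the total error at [w] is at most [rnorm w * (e / 2 / n) *
   (rnorm u + rnorm v)]. *)
pose n := 1 + rnorm u + rnorm v.
have [u0 v0] := (rnorm_ge0 u, rnorm_ge0 v).
have n0 : 0 < n by rewrite /n; lra.
have d0 : 0 < e / 2 / n by rewrite !divr_gt0.
have [J uJ] := finite_approx u d0; have [K vK] := finite_approx v d0.
set u' := restr _ u in uJ; set v' := restr _ v in vK.
exists (rank_one u' v').
  split; first exact: rank_one_bounded.
  have [_ Esub _ _ _] := hE.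
  apply: Esub (finite_entourage [seq (x, x') | x <- K, x' <- J]) => -[x x'] /=.
  rewrite /supp/= inner_delta ell2_scale inner_delta_l => nz.
  apply/allpairsP; exists (x, x'); split=> //=; apply: contraNT nz => nJ; apply/eqP.
    by rewrite [v' x]restrE memNset ?rmorph0 ?mul0r//= (negPf nJ).
  by rewrite [u' x']restrE memNset ?mulr0//= (negPf nJ).
apply/opnorm_ltP; exists (e / 2); split=> [||w]; [lra|lra|].
have -> : (rank_one u v - rank_one u' v') w
    = inner w v *: (u - u') + inner w (v - v') *: u'.
  rewrite -[LHS]/(inner w v *: u - inner w v' *: u') innerBr scalerBr scalerBl.
  by rewrite addrA subrK.
rewrite (le_trans (rnormD _ _))// !rnormZ.
have b1 : normc (inner w v) * rnorm (u - u') <= rnorm w * rnorm v * (e / 2 / n).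
  by rewrite ler_pM ?normc_ge0 ?rnorm_ge0 ?cauchy_schwarz.
have b2 : normc (inner w (v - v')) * rnorm u' <= rnorm w * (e / 2 / n) * rnorm u.
  rewrite ler_pM ?normc_ge0 ?rnorm_ge0 ?rnorm_restr//.
  by rewrite (le_trans (cauchy_schwarz _ _))// ler_wpM2l ?rnorm_ge0.
apply: le_trans (lerD b1 b2) _.
rewrite [leRHS](_ : _ = rnorm w * (e / 2 / n) * n); last first.
  by rewrite -[RHS]mulrA divfK ?gt_eqF// mulrC.
have : 0 <= rnorm w * (e / 2 / n) by rewrite mulr_ge0 ?rnorm_ge0// ltW.
rewrite /n; set c := _ * (_ / _).
rewrite (_ : rnorm w * rnorm v * _ = c * rnorm v); last first.
  by rewrite mulrAC.
lra.
Qed.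

End rank_one.

(** * Positive definite kernels and Schur multipliers *)

Section gram_kernels.
Variables (R : realType) (Y : eqType).
Implicit Types (s : seq Y) (k : Y -> Y -> R) (L : seq (Y -> R)).

(** These are the real positive semidefinite kernels of finite rank, given by an explicit list of
    feature functions. *)
Definition gram L (y y' : Y) : R := \sum_(w <- L) w y * w y'.

Lemma gram_add L L' y y' : gram (L ++ L') y y' = gram L y y' + gram L' y y'.
Proof. by rewrite /gram big_cat. Qed.

Lemma gram_scale (g : Y -> R) L y y' :
  gram [seq (fun z => g z * w z) | w <- L] y y' = g y * g y' * gram L y y'.
Proof.
by rewrite /gram big_map mulr_sumr; apply: eq_bigr => w _; ring.
Qed.

Lemma gram_mul L L' y y' :
  gram [seq (fun z => w z * w' z) | w <- L, w' <- L'] y y'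
  = gram L y y' * gram L' y y'.
Proof.
rewrite /gram big_allpairs_dep/= mulr_suml; apply: eq_bigr => w _.
by rewrite mulr_sumr; apply: eq_bigr => w' _; ring.
Qed.

Lemma gram_exp L n : exists L', forall y y', gram L' y y' = gram L y y' ^+ n.
Proof.
elim: n => [|n [L' L'E]].
  by exists [:: fun=> 1] => y y'; rewrite /gram big_seq1 mulr1 expr0.
exists [seq (fun z => w z * w' z) | w <- L, w' <- L'] => y y'.
by rewrite gram_mul L'E exprS.
Qed.

(** The Taylor coefficients of the exponential are nonnegative, so their square roots can be
    absorbed into the feature functions of the powers. *)
Lemma gram_exp_coeff L n :
  exists L', forall y y', gram L' y y' = series (exp_coeff (gram L y y')) n.
Proof.
elim: n => [|n [L' L'E]].
  by exists [::] => y y'; rewrite /gram big_nil /series/= big_geq.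
have [L1 L1E] := gram_exp L n.
exists (L' ++ [seq (fun z => Num.sqrt (n`!%:R^-1) * w z) | w <- L1]) => y y'.
rewrite gram_add gram_scale L'E L1E /series/= big_nat_recr//=.
by rewrite -expr2 sqr_sqrtr ?invr_ge0// exp_coeffE.
Qed.

(* Gram-Schmidt: the residual vectors [v'] vanish on [s]. *)
Lemma gram_schmidt (H : innerProductType R[i]) (v : Y -> H) s :
  exists L (v' : Y -> H), (forall y, y \in s -> v' y = 0) /\
    forall y y', rinner (v y) (v y') = gram L y y' + rinner (v' y) (v' y').
Proof.
elim: s => [|y0 s [L [v' [v'0 v'E]]]].
  by exists [::], v; split=> // y y'; rewrite /gram big_nil add0r.
have [y00|y00] := eqVneq (rnorm (v' y0)) 0.
  exists L, v'; split=> // y; rewrite inE => /orP[/eqP->|]; last exact: v'0.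
  exact: rnorm0_eq0.
pose n := rnorm (v' y0); pose p y := rinner (v' y) (v' y0) / n.
(* This removes the orthogonal projection onto [v' y0] for the real inner product [rinner]; [p] is
   the coefficient against the unit vector. *)
exists (p :: L), (fun y => v' y - (p y / n)%:C *: v' y0); split=> [y|y y'].
  rewrite inE => /orP[/eqP->|/v'0 v'y].
    by rewrite /p /rinner inner_self/= expr2 !mulfK// divff// scale1r subrr.
  by rewrite /p v'y /rinner inner0l/= !mul0r scale0r subr0.
have reZ (r : R) (z : R[i]) : complex.Re (r%:C * z) = r * complex.Re z.
  by case: z => a b /=; rewrite mul0r subr0.
have sym (u w : H) : rinner u w = rinner w u.
  by rewrite /rinner inner_conj; case: (inner w u).
rewrite v'E /gram big_cons -/(gram L y y').
rewrite {2}/rinner !innerBl !innerBr !innerZl !innerZr !raddfB/= !conj_real !reZ.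
rewrite -!/(rinner _ _) (sym (v' y0) (v' y')).
have -> : rinner (v' y0) (v' y0) = n ^+ 2 by rewrite /rinner inner_self.
have pE z : rinner (v' z) (v' y0) = p z * n by rewrite /p divfK.
rewrite !pE.
by field; exact: y00.
Qed.

(** Expanding the square, the Gaussian is [g y * g y' * expR (2 * t * rinner (f y) (f y'))]. On [s]
    the inner products form a Gram kernel by Gram-Schmidt, and the Taylor partial sums of its
    exponential stay Gram kernels. *)
Lemma gram_gaussian (H : innerProductType R[i]) (f : Y -> H) s (t e : R) :
  0 <= t -> 0 < e ->
  exists L, forall y y', y \in s -> y' \in s ->
    `|gram L y y' - expR (- (t * rnorm (f y - f y') ^+ 2))| <= e.
Proof.
move=> t0 e0; have [L [v' [v'0 LE]]] := gram_schmidt f s.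
pose g y := expR (- (t * rnorm (f y) ^+ 2)).
pose L2 := [seq (fun z => Num.sqrt (2 * t) * w z) | w <- L].
have L2E y y' : y \in s -> gram L2 y y' = 2 * t * rinner (f y) (f y').
  move=> ys; rewrite gram_scale -expr2 sqr_sqrtr ?mulr_ge0// LE (v'0 _ ys).
  by rewrite [rinner 0 _]/rinner inner0l addr0.
(* One truncation order has to serve all the finitely many pairs at once. *)
have near_exp (s1 : seq (Y * Y)) : \forall n \near \oo, forall p, p \in s1 ->
    `|series (exp_coeff (gram L2 p.1 p.2)) n - expR (gram L2 p.1 p.2)| <= e.
  elim: s1 => [|p0 s1 IHs]; first exact: nearW.
  have /cvgrPdist_le/(_ _ e0) := is_cvg_series_exp_coeff (gram L2 p0.1 p0.2).
  move=> cvp; near=> n => p; rewrite inE => /orP[/eqP->|].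
    by rewrite distrC; near: n; exact: cvp.
  by move: p; near: n.
have [N _ /(_ N (leqnn N)) NE] := near_exp [seq (y, y') | y <- s, y' <- s].
have [L3 L3E] := gram_exp_coeff L2 N.
exists [seq (fun z => g z * w z) | w <- L3] => y y' ys y's.
rewrite gram_scale L3E rnormB_sqr.
have -> : expR (- (t * (rnorm (f y) ^+ 2 + rnorm (f y') ^+ 2
    - 2 * rinner (f y) (f y')))) = g y * g y' * expR (gram L2 y y').
  by rewrite L2E// /g -!expRD; congr expR; ring.
rewrite -mulrBr normrM.
have g1 z : 0 <= g z <= 1.
  by rewrite /g expR_ge0/= -[leRHS]expR0 ler_expR oppr_le0 mulr_ge0// sqr_ge0.
have gg : `|g y * g y'| <= 1.
  have /andP[a b] := g1 y; have /andP[c d] := g1 y'.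
  by rewrite ger0_norm ?mulr_ge0// mulr_ile1.
rewrite -[leRHS]mul1r ler_pM// (NE (y, y'))//; apply/allpairsP.
by exists (y, y').
Unshelve. all: by end_near. Qed.

End gram_kernels.

Section schur_multiplier.
Variables (R : realType) (Y : choiceType).

(** The quadratic form at [a], cut to [K], of the Schur product of [k] with the matrix of [T]. *)
Definition rquad (K : {fset Y}) (k : Y -> Y -> R) (T : ell2 R Y -> ell2 R Y)
    (a : Y -> R[i]) : R[i] :=
  \sum_(y <- K) \sum_(y' <- K)
    (k y y')%:C * (a y * (a y')^*%R * inner (T (delta R y)) (delta R y')).

Lemma rquad1 K T a : linear T ->
  rquad K (fun _ _ => 1) T a = inner (T (fvec K a)) (fvec K a).
Proof.
move=> linT; rewrite /rquad /fvec (lin_sum linT) inner_suml.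
apply: eq_bigr => y _; rewrite inner_sumr; apply: eq_bigr => y' _.
by rewrite lin_scale// innerZl innerZr mul1r -!mulrA.
Qed.

(* A Gram kernel splits the form into the values of [T] at the vectors [w a]. *)
Lemma rquad_gram K L T a (c : R) : linear T ->
  (forall b, normc (inner (T (fvec K b)) (fvec K b)) <= c * rnorm (fvec K b) ^+ 2) ->
  normc (rquad K (gram L) T a) <= c * \sum_(y <- K) gram L y y * normc (a y) ^+ 2.
Proof.
move=> linT Tc.
have -> : rquad K (gram L) T a
    = \sum_(w <- L) inner (T (fvec K (fun y => (w y)%:C * a y)))
                          (fvec K (fun y => (w y)%:C * a y)).
  under [RHS]eq_bigr do rewrite -rquad1//.
  rewrite /rquad [RHS]exchange_big/=; apply: eq_bigr => y _.
  rewrite [RHS]exchange_big/=; apply: eq_bigr => y' _.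
  rewrite /gram rmorph_sum mulr_suml/=; apply: eq_bigr => w _.
  by rewrite rmorphM/= [((w y')%:C * a y')^*%R]rmorphM/= conj_real; ring.
apply: le_trans (normc_sum _ _ _) _.
apply: (@le_trans _ _ (\sum_(w <- L) c * rnorm (fvec K (fun y => (w y)%:C * a y)) ^+ 2)).
  by apply: ler_sum => w _; exact: Tc.
rewrite -mulr_sumr; under eq_bigr do rewrite rnorm_fvec.
rewrite exchange_big/=; under [in leRHS]eq_bigr do rewrite /gram mulr_suml.
rewrite le_eqVlt; apply/orP; left; apply/eqP; congr (_ * _).
apply: eq_bigr => y _; apply: eq_bigr => w _.
by rewrite normcM normc_real exprMn real_normK ?num_real// expr2.
Qed.

End schur_multiplier.

(** * Coarse embeddings into Hilbert spaces *)

Section coarse_geometry.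
Variables (R : realType).

(** The sets of pairs at bounded distance form a coarse structure containing the generators, so
    minimality applies. *)
Lemma bounded_entourage (H : hilbertType R[i]) (A : set (H * H)) :
  bounded_coarse_structure (fun u v : H => `|u - v|) A ->
  exists2 r : R, 0 <= r & forall u v, A (u, v) -> rnorm (u - v) <= r.
Proof.
pose B := [set A : set (H * H) |
  exists2 r : R, 0 <= r & forall u v, A (u, v) -> rnorm (u - v) <= r].
apply: (@smallest_sub _ _ _ B).
  split.
  - by exists 0 => // u v uv; have -> : u = v := uv; rewrite subrr rnorm0.
  - by move=> A1 A2 A21 [r r0 rA]; exists r => // u v /A21; exact: rA.
  - by move=> A1 [r r0 rA]; exists r => // u v /= uv; rewrite rnormB; exact: rA.
  - move=> A1 A2 [r r0 rA] [r' r'0 rA']; exists (r + r') => [|u v]; first exact: addr_ge0.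
    by move=> [] h; [have := rA _ _ h|have := rA' _ _ h]; lra.
  - move=> A1 A2 [r r0 rA] [r' r'0 rA']; exists (r + r') => [|u v]; first exact: addr_ge0.
    move=> [z /= Auz Azv]; have uz := rA' _ _ Auz; have zv := rA _ _ Azv.
    have := rnormD (u - z) (z - v); rewrite addrA subrK; lra.
move=> _ [s s0 <-]; exists (complex.Re s) => [|u v /=].
  by move: s0; rewrite /mkset lecE => /andP[].
by rewrite rnormE lecE => /andP[].
Qed.

(** The pulled-back norm distance determines [E]. The second clause is the second half of the
    embedding property, applied to the pairs within distance [r] and read contrapositively. *)
Lemma hilbert_embedding_metrizes (X : Type) (E : set (set (X * X))) :
  coarse_structure E -> coarsely_embeds_into_hilbert R E ->
  exists (H : hilbertType R[i]) (f : X -> H),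
    (forall A, E A -> exists2 r : R, 0 <= r &
       forall x x', A (x, x') -> rnorm (f x - f x') <= r) /\
    (forall r : R, 0 <= r -> E [set p | rnorm (f p.1 - f p.2) <= r]).
Proof.
move=> [_ Esub _ _ _] [H [f [fE Ef]]]; exists H, f; split=> [A EA|r r0].
  have [B /bounded_entourage[r r0 rB] AB] := fE _ EA.
  by exists r => // x x' /AB/rB.
have [|A EA fA] := Ef [set p | `|p.1 - p.2| <= r%:C].
  by apply: sub_gen_smallest; exists r%:C; rewrite //= ler0c.
apply: Esub EA => -[x x'] /= fxx'; apply: contrapT => /fA; apply => /=.
by rewrite rnorm_le.
Qed.

Lemma hilbert_embedding_connected (X : Type) (E : set (set (X * X))) :
  coarse_structure E -> coarsely_embeds_into_hilbert R E ->
  forall x x', exists2 A, E A & A (x, x').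
Proof.
move=> hE /(hilbert_embedding_metrizes hE)[H [f [_ fE]]] x x'.
exists [set p | rnorm (f p.1 - f p.2) <= rnorm (f x - f x')]; rewrite //=.
exact/fE/rnorm_ge0.
Qed.

Lemma fiber_count (Y : choiceType) (A : set (Y * Y)) (n : nat) (K : {fset Y}) y :
  ([set y' | A (y, y')] #<= `I_n)%card ->
  \sum_(y' <- K) ((y, y') \in A)%:R <= n%:R :> R.
Proof.
move=> An; rewrite -natr_sum ler_nat.
pose s := [seq y' <- K | (y, y') \in A].
have -> : \sum_(y' <- K) nat_of_bool ((y, y') \in A) = size s.
  rewrite size_filter -sum1_count [RHS]big_mkcond.
  by apply: eq_bigr => y' _; case: (_ \in A).
have -> : size s = #|` [fset y' in s]%fset|.
  by rewrite card_fseq undup_id// filter_uniq.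
rewrite -[[fset y' in s]%fset]set_fsetK; apply: geq_card_fset_set.
apply: card_le_trans An; apply: subset_card_le => y' /=.
by rewrite !inE mem_filter => /andP[/set_mem].
Qed.

End coarse_geometry.

(** * Banded operators close to rank one projections *)

Section rank_one_concentration.
Variables (R : realType) (Y : choiceType).
Implicit Types (K : {fset Y}) (k : Y -> Y -> R) (a : Y -> R[i]).

(** A Schur test: [p * q <= (p ^+ 2 + q ^+ 2) / 2] splits each term of the double sum, and each row
    and each column has at most [n] nonzero entries. *)
Lemma rquad_banded K k (T : ell2 R Y -> ell2 R Y) a (A : set (Y * Y)) (n : nat)
    (M e : R) :
  0 <= M -> 0 <= e -> supp T `<=` A ->
  (forall u, rnorm (T u) <= M * rnorm u) ->
  (forall y, ([set y' | A (y, y')] #<= `I_n)%card) ->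
  (forall y, ([set y' | A (y', y)] #<= `I_n)%card) ->
  (forall y y', y \in K -> y' \in K -> A (y, y') -> `|k y y' - 1| <= e) ->
  normc (rquad K k T a - rquad K (fun _ _ => 1) T a)
    <= e * M * n%:R * \sum_(y <- K) normc (a y) ^+ 2.
Proof.
move=> M0 e0 TA TM An nA ke.
pose m y y' : R := ((y, y') \in A)%:R.
have entry y y' : normc (inner (T (delta R y)) (delta R y')) <= M * m y y'.
  have [yA|yA] := pselect (A (y, y')).
    rewrite /m mem_set// mulr1 inner_delta (le_trans (coord_le_rnorm _ _))//.
    by rewrite (le_trans (TM _))// rnorm_delta mulr1.
  rewrite (_ : inner _ _ = 0) ?normc0 ?mulr_ge0//.
  by apply: contrapT => /eqP nz; exact: yA (TA (y, y') nz).
rewrite /rquad -sumrB (le_trans (normc_sum _ _ _))//.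
apply: (@le_trans _ _ (\sum_(y <- K) \sum_(y' <- K)
  (e * M / 2 * (m y y' * normc (a y) ^+ 2 + m y y' * normc (a y') ^+ 2)))).
  rewrite big_seq [leRHS]big_seq; apply: ler_sum => y yK.
  rewrite -sumrB (le_trans (normc_sum _ _ _))//.
  rewrite big_seq [leRHS]big_seq; apply: ler_sum => y' y'K.
  rewrite -mulrBl -rmorphB/= !normcM normc_conj normc_real.
  have kM : `|k y y' - 1| * normc (inner (T (delta R y)) (delta R y')) <= e * (M * m y y').
    have [yA|yA] := pselect (A (y, y')).
      by rewrite ler_pM ?normc_ge0// ke.
    have := entry y y'; rewrite /m memNset// mulr0 => /le_gtF.
    have := normc_ge0 (inner (T (delta R y)) (delta R y')).
    by rewrite le_eqVlt => /orP[/eqP<-|->//]; rewrite !mulr0.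
  move: (normc_ge0 (a y)) (normc_ge0 (a y')) kM.
  move: (normc (a y)) (normc (a y')) => p q p0 q0 kM.
  rewrite mulrCA.
  apply: le_trans (ler_wpM2l (mulr_ge0 p0 q0) kM) _.
  rewrite (_ : _ * (e * _) = e * M * m y y' * (p * q)); last by ring.
  rewrite [leRHS](_ : _ = e * M * m y y' * ((p ^+ 2 + q ^+ 2) / 2)); last by ring.
  rewrite ler_wpM2l ?mulr_ge0//.
  by have := sqr_ge0 (p - q); lra.
under eq_bigr do rewrite -mulr_sumr big_split/=.
rewrite -mulr_sumr big_split/=.
set s := \sum_(y <- K) normc (a y) ^+ 2.
have b1 : \sum_(y <- K) \sum_(y' <- K) m y y' * normc (a y) ^+ 2 <= n%:R * s.
  rewrite /s mulr_sumr; apply: ler_sum => y _.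
  by rewrite -mulr_suml ler_wpM2r ?sqr_ge0// fiber_count.
have b2 : \sum_(y <- K) \sum_(y' <- K) m y y' * normc (a y') ^+ 2 <= n%:R * s.
  rewrite exchange_big /s mulr_sumr/=; apply: ler_sum => y _.
  rewrite -mulr_suml ler_wpM2r ?sqr_ge0//.
  rewrite (eq_bigr (fun y' => ((y, y') \in [set p | A (p.2, p.1)])%:R)); first exact/fiber_count/nA.
  by move=> y' _; congr (_%:R); congr nat_of_bool; apply/idP/idP => /set_mem h; exact/mem_set.
have eM : 0 <= e * M / 2 by rewrite !mulr_ge0// invr_ge0.
apply: le_trans (ler_wpM2l eM (lerD b1 b2)) _.
by rewrite le_eqVlt; apply/orP; left; apply/eqP; field.
Qed.

Lemma rquad_sub K k (S T : ell2 R Y -> ell2 R Y) a :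
  rquad K k (fun u => S u - T u) a = rquad K k S a - rquad K k T a.
Proof.
rewrite /rquad -sumrB; apply: eq_bigr => y _; rewrite -sumrB.
by apply: eq_bigr => y' _; rewrite innerBl !mulrBr.
Qed.

Lemma rquad_rank_one K k (xi : ell2 R Y) :
  rquad K k (rank_one xi xi) xi
  = (\sum_(y <- K) \sum_(y' <- K)
       k y y' * (normc (xi y) ^+ 2 * normc (xi y') ^+ 2))%:C.
Proof.
rewrite /rquad rmorph_sum; apply: eq_bigr => y _.
rewrite rmorph_sum; apply: eq_bigr => y' _.
rewrite rmorphM/= rmorphM/= -!sqr_normc innerZl inner_delta inner_delta_l.
by congr (_ * _); ring.
Qed.

(* Schur multiplication by a Gaussian of the embedding barely changes the
   banded [S], whereas it nearly kills a rank one projection spread thinly. *)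
Lemma rank_one_concentration (F : set (set (Y * Y))) (S : ell2 R Y -> ell2 R Y)
    (e : R) :
  coarse_structure F -> uniformly_locally_finite F ->
  coarsely_embeds_into_hilbert R F -> bounded_operator S -> F (supp S) ->
  0 < e -> e <= 1 ->
  exists2 d : R, 0 < d & forall K (xi : ell2 R Y), rnorm xi <= 1 ->
    (forall y, normc (xi y) ^+ 2 <= d) ->
    (forall b, normc (inner (S (fvec K b) - rank_one xi xi (fvec K b)) (fvec K b))
       <= e * rnorm (fvec K b) ^+ 2) ->
    (\sum_(y <- K) normc (xi y) ^+ 2) ^+ 2 <= 6 * e.
Proof.
move=> hF ulf emb bS FS e0 e1.
have [_ Fsub Finv _ _] := hF.
have [H [f [fF Ff]]] := hilbert_embedding_metrizes hF emb.
have /bounded_operatorP[linS [M M0 SM]] := bS.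
have [r r0 fr] := fF _ FS.
have [n1 Sn1] := ulf _ FS; have [n2 Sn2] := ulf _ (Finv _ FS).
pose n := maxn n1 n2.
have Sn y : ([set y' | supp S (y, y')] #<= `I_n)%card.
  by apply: card_le_trans (Sn1 y) _; rewrite card_le_II leq_maxl.
have nS y : ([set y' | supp S (y', y)] #<= `I_n)%card.
  by apply: card_le_trans (Sn2 y) _; rewrite card_le_II leq_maxr.
(* [h] is the deviation of the kernel from 1 allowed on the support of [S]; it makes the bound of
   [rquad_banded] at most [e]. *)
pose h := e / (M * n%:R + 1).
have Mn1 : 0 < M * n%:R + 1 by rewrite ltr_wpDl// mulr_ge0.
have h0 : 0 < h by rewrite divr_gt0.
have he : h <= e.
  by rewrite ler_pdivrMr// ler_peMr ?(ltW e0)// lerDr mulr_ge0.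
have hMn : h * M * n%:R <= e.
  rewrite -mulrA {1}/h mulrAC ler_pdivrMr// ler_wpM2l ?(ltW e0)//.
  by rewrite lerDl.
(* Within distance [r] one has [1 - g <= t * r ^+ 2], which this choice keeps below [h / 2]; the
   other half of [h] goes to the Gram approximation. *)
pose t := h / 2 / (r ^+ 2 + 1).
have r21 : 0 < r ^+ 2 + 1 by rewrite ltr_wpDl// sqr_ge0.
have t0 : 0 < t by rewrite !divr_gt0.
pose g (y y' : Y) := expR (- (t * rnorm (f y - f y') ^+ 2)).
have g1 y y' : g y y' <= 1.
  by rewrite /g -[leRHS]expR0 ler_expR oppr_le0 mulr_ge0 ?sqr_ge0// ltW.
have gS y y' : supp S (y, y') -> 1 - g y y' <= h / 2.
  move=> /fr; rewrite -(@ler_pXn2r _ 2)// ?nnegrE ?rnorm_ge0// => fyr.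
  have : t * rnorm (f y - f y') ^+ 2 <= h / 2.
    rewrite (le_trans (ler_wpM2l (ltW t0) fyr))// /t mulrAC ler_pdivrMr//.
    rewrite mulrDr mulr1 lerDl. by rewrite divr_ge0// ltW.
  have := expR_ge1Dx (- (t * rnorm (f y - f y') ^+ 2)); rewrite -/(g y y'); lra.
have et0 : 0 <= 2 / e / t by rewrite !divr_ge0// ltW.
(* Beyond distance [q], [t] times the squared distance exceeds [2 / e], and [1 + s <= expR s] gives
   [g <= e / 2]. *)
pose q := Num.sqrt (2 / e / t).
have [n0 qn0] := ulf _ (Ff q (sqrtr_ge0 _)).
have gq y y' : q < rnorm (f y - f y') -> g y y' <= e / 2.
  rewrite -(@ltr_pXn2r _ 2)// ?nnegrE ?rnorm_ge0 ?sqrtr_ge0//.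
  rewrite sqr_sqrtr// ltr_pdivrMr// mulrC => qf.
  rewrite /g expRN -[leRHS]invrK lef_pV2 ?posrE ?expR_gt0 ?invr_gt0 ?divr_gt0//.
  rewrite invf_div; have := expR_ge1Dx (t * rnorm (f y - f y') ^+ 2); lra.
(* A [q]-ball has at most [n0] points, hence mass at most [n0 * d], and the kernel is at most 2
   there. *)
pose d := e / (2 * (n0%:R + 1)).
have n01 : 0 < 2 * (n0%:R + 1) :> R by rewrite mulr_gt0// ltr_wpDl.
exists d => [|K xi xi1 xid Kb]; first by rewrite divr_gt0.
have [L LE] := gram_gaussian f K (ltW t0) (divr_gt0 h0 (ltr0Sn R 1)).
set k := gram L.
have kg y y' : y \in K -> y' \in K -> `|k y y' - g y y'| <= h / 2 by exact: LE.
pose P := rank_one xi xi; pose T u := S u - P u.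
have /bounded_operatorP[linP _] := rank_one_bounded xi xi.
have linT : linear T.
  by move=> a u v; rewrite /T linS [P _]linP scalerBr opprD addrACA.
set l := \sum_(y <- K) _.
have l0 : 0 <= l by rewrite sumr_ge0// => y _; rewrite sqr_ge0.
have l1 : l <= 1.
  rewrite (le_trans (fsum_le_rnorm _ _))// -[leRHS](expr1n _ 2).
  by rewrite ler_pXn2r// nnegrE ?rnorm_ge0.
have bT1 : normc (rquad K (fun _ _ => 1) T xi) <= e.
  rewrite rquad1// (le_trans (Kb _))// rnorm_fvec -/l.
  by rewrite -[leRHS]mulr1 ler_wpM2l// ltW.
(* [k] only approximates the Gaussian, so its diagonal is near 1 rather than equal to 1. *)
have k2 y : y \in K -> k y y <= 2.
  by move=> yK; have := kg y y yK yK; have := g1 y y; rewrite ler_distl => + /andP[]; lra.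
have bTk : normc (rquad K k T xi) <= 2 * e.
  rewrite (le_trans (rquad_gram _ _ linT Kb))// mulrC ler_wpM2r ?(ltW e0)//.
  apply: (@le_trans _ _ (\sum_(y <- K) 2 * normc (xi y) ^+ 2)).
    rewrite big_seq [leRHS]big_seq; apply: ler_sum => y yK.
    by rewrite ler_wpM2r ?sqr_ge0// k2.
  by rewrite -mulr_sumr -/l; lra.
have bS1k : normc (rquad K k S xi - rquad K (fun _ _ => 1) S xi) <= e.
  apply: le_trans (rquad_banded xi M0 (ltW h0) (@subset_refl _ _) SM Sn nS _) _.
    move=> y y' yK y'K /gS; have := kg _ _ yK y'K; have := g1 y y'.
    by rewrite !ler_distl => ? /andP[? ?] ?; apply/andP; split; lra.
  rewrite -/l -[leRHS]mulr1 ler_pM//.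
  exact: mulr_ge0 (mulr_ge0 (ltW h0) M0) (ler0n _ _).
have P1 : rquad K (fun _ _ => 1) P xi = (l ^+ 2)%:C.
  rewrite rquad_rank_one; congr (_%:C); rewrite expr2 {1}/l mulr_suml.
  apply: eq_bigr => y _; rewrite /l mulr_sumr.
  by apply: eq_bigr => y' _; rewrite mul1r.
(* Far pairs have [|k| <= e] and contribute at most [e] in total. Near pairs also contribute at most
   [e], as [xi] has little mass on each [q]-ball. *)
have Pk : normc (rquad K k P xi) <= 2 * e.
  rewrite rquad_rank_one normc_real.
  pose m y y' : R := ((y, y') \in [set p | rnorm (f p.1 - f p.2) <= q])%:R.
  have kb y y' : y \in K -> y' \in K -> `|k y y'| <= e + 2 * m y y'.
    move=> yK y'K; have := kg _ _ yK y'K; rewrite ler_distl => /andP[ka kb].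
    have g0 : 0 <= g y y' := expR_ge0 _.
    have [fq|fq] := leP (rnorm (f y - f y')) q.
      rewrite /m mem_set//= mulr1; have := g1 y y'; rewrite ler_norml => ?.
      by apply/andP; split; lra.
    rewrite /m memNset/= ?mulr0; last by rewrite leNgt fq.
    by have := gq _ _ fq; rewrite ler_norml => ?; apply/andP; split; lra.
  apply: le_trans (ler_norm_sum _ _ _) _.
  apply: (@le_trans _ _ (\sum_(y <- K) \sum_(y' <- K)
      (e * (normc (xi y) ^+ 2 * normc (xi y') ^+ 2) + 2 * d * (normc (xi y) ^+ 2 * m y y')))).
    rewrite big_seq [leRHS]big_seq; apply: ler_sum => y yK.
    apply: le_trans (ler_norm_sum _ _ _) _.
    rewrite big_seq [leRHS]big_seq; apply: ler_sum => y' y'K.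
    have p0 : 0 <= normc (xi y) ^+ 2 by rewrite sqr_ge0.
    have q0 : 0 <= normc (xi y') ^+ 2 by rewrite sqr_ge0.
    have m0 : 0 <= m y y' by rewrite ler0n.
    rewrite normrM (ger0_norm (mulr_ge0 p0 q0)).
    apply: le_trans (ler_wpM2r (mulr_ge0 p0 q0) (kb _ _ yK y'K)) _.
    have := ler_wpM2l (mulr_ge0 p0 m0) (xid y'); lra.
  under eq_bigr do rewrite big_split/= -!mulr_sumr.
  rewrite big_split/= -!mulr_sumr -/l.
  rewrite -mulr_suml -/l.
  have mn : \sum_(y <- K) normc (xi y) ^+ 2 * (\sum_(y' <- K) m y y') <= l * n0%:R.
    rewrite /l mulr_suml; apply: ler_sum => y _; rewrite ler_wpM2l ?sqr_ge0//.
    by apply: fiber_count; exact: qn0.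
  have ln0 : l * n0%:R <= n0%:R + 1.
    by rewrite (@le_trans _ _ (1 * n0%:R))// ?ler_wpM2r// mul1r lerDl.
  have d2 : 2 * d * (n0%:R + 1) = e.
    by rewrite /d; field; rewrite gt_eqF// ltr_wpDl.
  have d20 : 0 <= 2 * d by rewrite mulr_ge0// divr_ge0// ltW.
  have := ler_wpM2l d20 (le_trans mn ln0); rewrite d2.
  have : e * (l * l) <= e by rewrite -[leRHS]mulr1 ler_wpM2l ?(ltW e0)// mulr_ile1.
  lra.
have : normc (l ^+ 2)%:C = l ^+ 2 by rewrite normc_real ger0_norm ?sqr_ge0.
rewrite -P1 => <-.
(* This is [P = S - T], used with the kernel [k] and with the kernel 1; the four terms are at most
   [2 * e], [2 * e], [e] and [e]. *)
have -> : rquad K (fun _ _ => 1) P xi = rquad K k P xi + rquad K k T xi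
    - (rquad K k S xi - rquad K (fun _ _ => 1) S xi) - rquad K (fun _ _ => 1) T xi.
  by rewrite !rquad_sub; ring.
have tri (z w : R[i]) : normc (z - w) <= normc z + normc w.
  by have := normcD z (- w); rewrite normcN.
have := tri (rquad K k P xi + rquad K k T xi
    - (rquad K k S xi - rquad K (fun _ _ => 1) S xi)) (rquad K (fun _ _ => 1) T xi).
have := tri (rquad K k P xi + rquad K k T xi)
    (rquad K k S xi - rquad K (fun _ _ => 1) S xi).
have := normcD (rquad K k P xi) (rquad K k T xi).
lra.
Qed.

End rank_one_concentration.

(** * The gliding hump *)

Section sparse_sequences.
Variables (R : realType) (X Y : choiceType) (xi : X -> ell2 R Y).
Hypothesis xi1 : forall x, rnorm (xi x) = 1.
Hypothesis xi_flat : forall d : R, 0 < d -> exists x, forall y, normc (xi x y) ^+ 2 <= d.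
Variable e : nat -> R.
Hypothesis e0 : forall n, 0 < e n.

(** One stage of the construction: from the finite set used so far and the stage number to the next
    point and an enlarged set holding nearly all the mass of its vector. *)
Let next (p : {fset Y} * nat) : exists q : X * {fset Y},
  [/\ (p.1 `<=` q.2)%fset,
      forall y, normc (xi q.1 y) ^+ 2 <= p.2.+1%:R^-1,
      \sum_(y <- p.1) normc (xi q.1 y) ^+ 2 <= e p.2 &
      rnorm (xi q.1 - restr [set` q.2] (xi q.1)) ^+ 2 <= e p.2].
Proof.
case: p => D n /=; pose c : R := (size D)%:R + 1.
have c0 : 0 < c by rewrite ltr_wpDl.
(* Coordinates below [e n / c] keep the mass on [D] below [e n]; the 1 in [c] covers an empty
   [D]. *)
have d0 : 0 < Num.min (n.+1%:R^-1) (e n / c) by rewrite lt_min invr_gt0 ltr0Sn divr_gt0.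
have [x xd] := xi_flat d0.
have se0 : 0 < Num.sqrt (e n) by rewrite sqrtr_gt0.
have [J xJ] := finite_approx (xi x) se0.
exists (x, (D `|` J)%fset); split=> /=.
- exact: fsubsetUl.
- by move=> y; rewrite (le_trans (xd y))// ge_min lexx.
- apply: (@le_trans _ _ (\sum_(y <- D) (e n / c))).
    by apply: ler_sum => y _; rewrite (le_trans (xd y))// ge_min lexx orbT.
  rewrite big_const_seq count_predT iter_addr_0 -mulr_natr -mulrA.
  rewrite -[leRHS]mulr1 ler_wpM2l ?(ltW (e0 n))// mulrC ler_pdivrMr// mul1r.
  by rewrite lerDl.
- rewrite -[leRHS](sqr_sqrtr (ltW (e0 n))) ler_pXn2r ?nnegrE ?rnorm_ge0 ?sqrtr_ge0//.
  apply: le_trans xJ; apply: rnorm_mono => y; rewrite !ell2_sub !restrE.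
  have [yJ|yJ] := boolP (y \in [set` J]).
    rewrite mem_set; first by rewrite subrr.
    by move/set_mem: yJ => /= yJ; rewrite inE yJ orbT.
  by case: ifP => _; rewrite ?subrr ?normc0 ?normc_ge0.
Qed.

(** The [K n] are the increments of an increasing sequence of finite sets [D n]. The vector of [x n]
    loses at most [e n] on [D n] and at most [e n] outside [D n.+1]. *)
Lemma sparse_sequence : exists (x : nat -> X) (K : nat -> {fset Y}),
  [/\ forall n y, normc (xi (x n) y) ^+ 2 <= n.+1%:R^-1,
      forall n, 1 - 2 * e n <= \sum_(y <- K n) normc (xi (x n) y) ^+ 2 &
      forall m n, m != n -> \sum_(y <- K n) normc (xi (x m) y) ^+ 2 <= e m].
Proof.
have [q qP] := choice next.
pose D := fix D n := if n is m.+1 then (q (D m, m)).2 else fset0.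
pose x n := (q (D n, n)).1.
have Dx n : [/\ (D n `<=` D n.+1)%fset,
    forall y, normc (xi (x n) y) ^+ 2 <= n.+1%:R^-1,
    \sum_(y <- D n) normc (xi (x n) y) ^+ 2 <= e n &
    rnorm (xi (x n) - restr [set` D n.+1] (xi (x n))) ^+ 2 <= e n] := qP (D n, n).
have mono m n : (m <= n)%N -> (D m `<=` D n)%fset.
  move/subnK => <-; elim: (n - m)%N => [|k IH] //.
  by rewrite addSn (fsubset_trans IH)//; have [] := Dx (k + m)%N.
have sub_sum (A B : {fset Y}) (f : ell2 R Y) : (A `<=` B)%fset ->
    \sum_(y <- A) normc (f y) ^+ 2 <= \sum_(y <- B) normc (f y) ^+ 2.
  move=> AB; rewrite [leRHS](big_fsetID _ (mem A))/=.
  rewrite (_ : [fset y in B | y \in A]%fset = A); last first.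
    apply/fsetP => y; rewrite !inE/= andbC.
    by have [/(fsubsetP AB) ->|] := boolP (y \in A).
  by rewrite lerDl sumr_ge0// => y _; rewrite sqr_ge0.
exists x, (fun n => (D n.+1 `\` D n)%fset); split=> [n|n|m n mn].
- by have [] := Dx n.
- have [DD _ inner outer] := Dx n.
  have total : 1 - e n <= \sum_(y <- D n.+1) normc (xi (x n) y) ^+ 2.
    have := restr_pythagoras [set` D n.+1] (xi (x n)); rewrite xi1 expr1n.
    rewrite restr_fvec -restr_fvec in outer *; rewrite restr_fvec rnorm_fvec -restr_fvec.
    by lra.
  rewrite (big_fsetID _ (mem (D n)))/= in total.
  have sI : \sum_(y <- [fset y in D n.+1 | y \in D n]%fset) normc (xi (x n) y) ^+ 2 <= e n.
    apply: le_trans inner; apply: sub_sum.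
    by apply/fsubsetP => y; rewrite !inE => /andP[].
  rewrite (_ : [fset y in D n.+1 | y \notin D n]%fset = (D n.+1 `\` D n)%fset) in total.
    by lra.
  by apply/fsetP => y; rewrite !inE andbC.
(* For [m < n] the set [K n] avoids [D m.+1]; for [n < m] it lies inside [D m]. *)
- have [mn'|nm] := ltnP m n.
    have [_ _ _ outer] := Dx m; apply: le_trans outer.
    apply: le_trans (fsum_le_rnorm _ (D n.+1 `\` D n)%fset).
    rewrite big_seq [leRHS]big_seq; apply: ler_sum => y.
    rewrite !inE => /andP[yDn _]; rewrite ell2_sub restrE memNset ?subr0//=.
    by move=> /(fsubsetP (mono _ _ mn')) ; rewrite (negPf yDn).
  have nm' : (n < m)%N by rewrite ltn_neqAle eq_sym mn.
  have [_ _ inner _] := Dx m; apply: le_trans inner; apply: sub_sum.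
  by apply: fsubset_trans (mono _ _ nm'); exact: fsubsetDl.
Qed.

End sparse_sequences.

(** * Lower bound on the coefficients of the unitary *)

Section unitary_coefficients.
Variables (R : realType) (X Y : choiceType) (F : set (set (Y * Y))).
Hypothesis (hF : coarse_structure F) (ulf : uniformly_locally_finite F).
Hypothesis emb : coarsely_embeds_into_hilbert R F.
Variables (U : ell2 R X -> ell2 R Y) (Us : ell2 R Y -> ell2 R X).
Hypothesis U_isometric : forall u, rnorm (U u) = rnorm u.
Hypothesis U_adjoint : is_adjoint U Us.

(* Away from [x n], the diagonal projection of the sequence [x] is small on the
   vectors supported on [K n]. *)
Let compressed_tail (x : nat -> X) (K : nat -> {fset Y}) (e : nat -> R) (c : R) n b :
  (forall m, 0 <= e m) -> (forall N, \sum_(m < N) e m <= c) ->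
  (forall m, m != n -> \sum_(y <- K n) normc (U (delta R (x m)) y) ^+ 2 <= e m) ->
  rnorm (restr (range x `\ x n) (Us (fvec (K n) b))) ^+ 2
    <= c * rnorm (fvec (K n) b) ^+ 2.
Proof.
move=> e0 ec xK; set v := fvec _ _.
have c0 : 0 <= c by rewrite (le_trans _ (ec 0%N))// big_ord0.
rewrite -[c]sqr_sqrtr// -exprMn ler_pXn2r// ?nnegrE ?mulr_ge0 ?rnorm_ge0 ?sqrtr_ge0//.
apply/rnorm_leP => [|J]; first by rewrite mulr_ge0 ?rnorm_ge0 ?sqrtr_ge0.
rewrite exprMn sqr_sqrtr//.
(* Since [v] lives on [K n], its inner product with [U (delta R (x m))] only sees the part on [K n],
   of squared norm at most [e m]. *)
have coef m : m != n -> normc (Us v (x m)) ^+ 2 <= rnorm v ^+ 2 * e m.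
  move=> mn; rewrite -inner_delta.
  have -> : inner (Us v) (delta R (x m)) = inner v (restr [set` K n] (U (delta R (x m)))).
    rewrite -inner_restr restr_fvec inner_conj -U_adjoint -inner_conj.
    by congr inner; apply: ell2_ext => y; rewrite /v !fvecE; case: (y \in K n).
  apply: (@le_trans _ _ ((rnorm v * rnorm (restr [set` K n] (U (delta R (x m))))) ^+ 2)).
    have cs := cauchy_schwarz v (restr [set` K n] (U (delta R (x m)))).
    by rewrite ler_pXn2r// nnegrE ?mulr_ge0 ?rnorm_ge0 ?normc_ge0.
  by rewrite exprMn ler_wpM2l ?sqr_ge0// restr_fvec rnorm_fvec xK.
(* [x] may repeat values, so one index is chosen per point; 0 is a default off the set. *)
have /choice[idx idxP] z : exists m, (range x `\ x n) z -> x m = z /\ m != n.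
  have [[[m _ <-] xmn]|nz] := pselect ((range x `\ x n) z); last by exists 0%N.
  by exists m; split=> //; apply/eqP => mn; apply: xmn; rewrite mn.
pose N := (\max_(z <- J) idx z).+1.
(* For each [m] at most one [z] in [J] equals [x m], so after exchanging the sums each [e m] counts
   at most once. *)
apply: (@le_trans _ _ (\sum_(z <- J) \sum_(m < N) (z == x m)%:R * (rnorm v ^+ 2 * e m))).
  rewrite big_seq [leRHS]big_seq; apply: ler_sum => z zJ.
  rewrite restrE; case: ifPn => [/set_mem/idxP[xz mn]|_]; last first.
    by rewrite normc0 expr0n sumr_ge0// => m _;
      exact: mulr_ge0 (ler0n _ _) (mulr_ge0 (sqr_ge0 _) (e0 _)).
  have zN : (idx z < N)%N by rewrite ltnS leq_bigmax_seq.
  rewrite (bigD1 (Ordinal zN))//= xz eqxx mul1r.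
  rewrite -{1}xz (le_trans (coef _ mn))// lerDl sumr_ge0// => m _.
  exact: mulr_ge0 (ler0n _ _) (mulr_ge0 (sqr_ge0 _) (e0 _)).
rewrite exchange_big/= mulrC.
apply: le_trans (ler_wpM2l (sqr_ge0 _) (ec N)); rewrite mulr_sumr.
apply: ler_sum => m _; rewrite -mulr_suml ler_piMl//; first exact: mulr_ge0 (sqr_ge0 _) (e0 _).
have [xJ|xJ] := boolP (x m \in J).
  rewrite (big_fsetD1 (x m))//= eqxx big_seq big1 ?addr0// => z.
  by rewrite !inE => /andP[/negPf-> _].
rewrite big_seq big1 ?ler01// => z zJ.
by have [zx|_] := eqVneq z (x m); [rewrite -zx zJ in xJ|].
Qed.

Lemma unitary_coefficients_bounded_below :
  (forall A : set X, uniform_roe R F (U \o restr A \o Us)) ->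
  exists2 d : R, 0 < d & forall x, exists y, d <= normc (inner (U (delta R x)) (delta R y)).
Proof.
move=> UF; apply: contrapT => nd.
pose xi x := U (delta R x).
have xi1 x : rnorm (xi x) = 1 by rewrite /xi U_isometric rnorm_delta.
have xi_flat (d : R) : 0 < d -> exists x, forall y, normc (xi x y) ^+ 2 <= d.
  move=> d0; apply: contrapT => /forallNP nx; apply: nd.
  exists (Num.sqrt d) => [|x]; first by rewrite sqrtr_gt0.
  have /existsNP[y /negP] := nx x; rewrite -ltNge => dy; exists y.
  rewrite inner_delta -(@ler_pXn2r _ 2)// ?nnegrE ?sqrtr_ge0 ?normc_ge0//.
  by rewrite sqr_sqrtr ltW.
(* The errors sum to at most 1/40, and each is at most 1/80. *)
pose e n : R := 1 / 40 / 2 ^+ n.+1.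
have e0 n : 0 < e n by rewrite !divr_gt0// exprn_gt0.
have e_sum N : \sum_(m < N) e m <= 1 / 40.
  suff -> : \sum_(m < N) e m = 1 / 40 - 1 / 40 / 2 ^+ N.
    by rewrite lerBlDr lerDl !divr_ge0// exprn_ge0.
  elim: N => [|N IH]; first by rewrite big_ord0 expr0 divr1 subrr.
  rewrite big_ord_recr/= IH /e exprS; field.
  by rewrite expf_neq0.
have [x [K [x_flat xK_in xK_out]]] := sparse_sequence xi1 xi_flat e0.
pose A := range x; pose Q := U \o restr A \o Us.
have [[linQ _] /(_ (1 / 40))[|S [bS FS]]] := UF A; first by rewrite divr_gt0.
move=> /opnorm_ltP[M [M0 M40 QS]].
(* The tolerance 1/20 pays 1/40 for the other terms of the sequence and 1/40 for replacing [Q] by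
   [S]. *)
have [||d d0 conc] := rank_one_concentration (e := 1 / 20) hF ulf emb bS FS.
- by rewrite divr_gt0.
- by lra.
have [n nd'] : exists n, n.+1%:R^-1 <= d.
  exists (Num.bound d^-1); rewrite -[leRHS]invrK lef_pV2 ?posrE ?invr_gt0//.
  rewrite (le_trans (ltW (archi_boundP _)))// ?invr_ge0 ?(ltW d0)//.
  by rewrite ler_nat leqnSn.
have := conc (K n) (xi (x n)); rewrite xi1 lexx => /(_ isT) {}conc.
have {}conc := conc (fun y => le_trans (x_flat n y) nd').
have en : e n <= 1 / 80.
  have : 1 <= 2 ^+ n :> R by rewrite exprn_ege1// ler1n.
  rewrite /e exprS ler_pdivrMr ?mulr_gt0 ?exprn_gt0//; lra.
suff /conc : forall b, normc (inner (S (fvec (K n) b)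
      - rank_one (xi (x n)) (xi (x n)) (fvec (K n) b)) (fvec (K n) b))
    <= 1 / 20 * rnorm (fvec (K n) b) ^+ 2.
  (* The concentration bound reads [l ^+ 2 <= 6 / 20], impossible for [l >= 9 / 10]. *)
  have := xK_in n; set l := \sum_(y <- _) _ => l_ge.
  have : 9 / 10 <= l by lra.
  nra.
move=> b; set v := fvec _ _; set p := rank_one _ _.
(* [Q - p] is the conjugate by [U] of the restriction to [A] without [x n], a self-adjoint
   idempotent, so its quadratic form is a squared norm. *)
have tail : inner (Q v - p v) v = (rnorm (restr (A `\ x n) (Us v)) ^+ 2)%:C.
  have pv : inner (p v) v = inner (restr [set x n] (Us v)) (Us v).
    have -> : restr [set x n] (Us v) = Us v (x n) *: delta R (x n).
      apply: ell2_ext => z; rewrite restrE ell2_scale /=.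
      have [->|/eqP zx] := eqVneq z (x n); first by rewrite mem_set// mulr1.
      by rewrite memNset// mulr0.
    have wE : Us v (x n) = inner v (xi (x n)).
      by rewrite -inner_delta inner_conj -U_adjoint -inner_conj.
    by rewrite [RHS]innerZl inner_delta_l wE [LHS]innerZl -inner_conj.
  rewrite innerBl pv /Q/= U_adjoint -innerBl.
  have -> : restr A (Us v) - restr [set x n] (Us v) = restr (A `\ x n) (Us v).
    apply: ell2_ext => z; rewrite ell2_sub !restrE.
    have [->|/eqP zx] := eqVneq z (x n).
      rewrite (@mem_set _ A) ?(@mem_set _ [set x n])//; last by exists n.
      by rewrite memNset ?subrr// => -[_]; apply.
    rewrite (@memNset _ [set x n])// subr0.
    have [zA|zA] := pselect (A z); first by rewrite !mem_set.
    by rewrite !memNset// => -[/zA].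
  by rewrite -restr_idem inner_restr restr_idem inner_self.
have -> : S v - p v = (Q v - p v) - (Q - S) v.
  by rewrite -[(Q - S) v]/(Q v - S v) opprB [RHS]addrC [RHS]addrA subrK.
rewrite innerBl; apply: le_trans (_ : _ <= normc (inner (Q v - p v) v)
    + normc (inner ((Q - S) v) v)) _.
  by apply: le_trans (normcD _ _) _; rewrite normcN.
have := compressed_tail b (fun m => ltW (e0 m)) e_sum (fun m mn => xK_out m n mn).
rewrite tail normc_real ger0_norm ?sqr_ge0// -/v -/A => b1.
have b2 : normc (inner ((Q - S) v) v) <= 1 / 40 * rnorm v ^+ 2.
  apply: le_trans (cauchy_schwarz _ _) _.
  rewrite expr2 mulrA ler_wpM2r ?rnorm_ge0// (le_trans (QS v))//.
  by rewrite ler_wpM2r ?rnorm_ge0// ltW.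
lra.
Qed.

End unitary_coefficients.

(** * Isomorphisms are spatial *)

Section spatial_implementation.
Variables (R : realType) (X Y : choiceType).
Variables (E : set (set (X * X))) (F : set (set (Y * Y))).
Hypotheses (hE : coarse_structure E) (hF : coarse_structure F).
Hypothesis conE : forall x x', exists2 A, E A & A (x, x').
Hypothesis conF : forall y y', exists2 A, F A & A (y, y').
Variable Phi : (ell2 R X -> ell2 R X) -> (ell2 R Y -> ell2 R Y).
Hypothesis hPhi : star_isomorphism (uniform_roe R E) (uniform_roe R F) Phi.

(* [U u] is the value of [Phi (rank_one u delta_x0)] at a unit vector [eta] of
   the range of the projection [Phi (rank_one delta_x0 delta_x0)]. *)
Lemma isomorphism_spatial (x0 : X) : exists (U : ell2 R X -> ell2 R Y) (Us : ell2 R Y -> ell2 R X),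
  Defs.is_unitary U Us /\ forall T, uniform_roe R E T -> Phi T = U \o T \o Us.
Proof.
have [[PhiF Phi_inj Phi_surj] Phi_lin Phi_comp Phi_adj] := hPhi.
pose d0 := delta R x0; pose p := rank_one d0 d0; pose P := Phi p.
have rE u v : uniform_roe R E (rank_one u v) := rank_one_uniform_roe hE conE u v.
have PhiE T : uniform_roe R E T -> linear (Phi T) by move=> /PhiF[[]].
have roe_lin T : uniform_roe R E T -> linear T by move=> [[]].
have Ep : uniform_roe R E p := rE _ _.
have E0 : uniform_roe R E 0.
  have -> : 0 = rank_one 0 d0 :> (ell2 R X -> ell2 R X).
    by apply/funext => z; rewrite /rank_one scaler0.
  exact: rE.
have Phi0 : Phi 0 = 0.
  have := Phi_lin (-1) _ _ Ep Ep.
  by rewrite !scaleN1r !addNr.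
have d00 : inner d0 d0 = 1 by rewrite inner_self rnorm_delta expr1n.
have pd0 : p d0 = d0 by rewrite /p /rank_one d00 scale1r.
have PP w : P (P w) = P w.
  have -> : P (P w) = (P \o P) w by [].
  rewrite -(Phi_comp _ _ Ep Ep) rank_one_comp ?pd0//.
  exact: roe_lin.
have [w Pw] : exists w, P w <> 0.
  apply: contrapT => /forallNP P0.
  have : p = 0.
    apply: (Phi_inj _ _ (mem_set Ep) (mem_set E0)).
    by rewrite Phi0; apply/funext => u; apply: contrapT; exact: P0.
  move=> /(congr1 (fun f => f d0)); rewrite pd0 => /(congr1 (@rnorm _ _)).
  by rewrite rnorm_delta rnorm0 => /eqP; rewrite oner_eq0.
have linP : linear P := PhiE _ Ep.
have n0 : rnorm (P w) != 0 by apply/eqP => /rnorm0_eq0.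
pose eta := ((rnorm (P w))^-1)%:C *: P w.
have Peta : P eta = eta by rewrite /eta lin_scale// PP.
have eta1 : inner eta eta = 1.
  rewrite inner_self rnormZ normc_real ger0_norm ?invr_ge0 ?rnorm_ge0//.
  by rewrite mulVf// expr1n.
pose U u := Phi (rank_one u d0) eta.
have Ulin : linear U.
  move=> a u v; rewrite /U.
  have lin : rank_one (a *: u + v) d0 = a *: rank_one u d0 + rank_one v d0.
    by apply/funext => z; rewrite /rank_one scalerDr scalerA mulrC -scalerA.
  have h := congr1 (fun f : ell2 R Y -> ell2 R Y => f eta)
    (Phi_lin a _ _ (rE u d0) (rE v d0)).
  by rewrite lin; exact h.
(* The adjoint of [rank_one u d0] composed with [rank_one v d0] is [inner v u] times [p], and [P]
   fixes [eta]. The summand 0 below fits the linearity clause for [Phi]. *)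
have Uinner u v : inner (U u) (U v) = inner u v.
  rewrite /U (Phi_adj _ _ (rE _ _) (rE _ _) (rank_one_adjoint _ _)).
  rewrite -[Phi _ (Phi _ eta)]/((Phi (rank_one d0 u) \o Phi (rank_one v d0)) eta).
  rewrite -(Phi_comp _ _ (rE _ _) (rE _ _)) (rank_one_comp _ _ (roe_lin _ (rE _ _))).
  have lin : rank_one (rank_one d0 u v) d0 = inner v u *: p + 0.
    by apply/funext => z; rewrite addr0 /rank_one scalerA mulrC -scalerA.
  have Phi_lin0 : Phi (inner v u *: p + 0) eta = inner v u *: eta.
    apply: etrans (congr1 (fun f : ell2 R Y -> ell2 R Y => f eta) (Phi_lin (inner v u) p 0 Ep E0)) _.
    by rewrite Phi0 -[LHS]/(inner v u *: P eta + 0) Peta addr0.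
  rewrite lin Phi_lin0.
  by rewrite innerZr eta1 mulr1 -inner_conj.
have Unorm u : rnorm (U u) = rnorm u.
  apply/eqP; rewrite -(@eqrXn2 _ 2)// ?rnorm_ge0//; apply/eqP/complexI.
  by rewrite -!inner_self Uinner.
(* Let [Phi S] be [rank_one v eta]. As [P] is self-adjoint and fixes [eta], also
   [Phi (S \o p) = Phi S], and evaluating at [eta] gives [U (S d0) = v]. *)
have /choice[Us UUs] v : exists u, U u = v.
  have [S ES PhiS] := Phi_surj _ (rank_one_uniform_roe hF conF v eta).
  have PhiSp : Phi (S \o p) = Phi S.
    rewrite (Phi_comp _ _ ES Ep) PhiS; apply/funext => z; rewrite /= /rank_one.
    rewrite (Phi_adj _ _ Ep Ep (rank_one_adjoint _ _)).
    by rewrite -/P Peta.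
  exists (S d0); rewrite /U -(rank_one_comp _ _ (roe_lin _ ES)).
  by rewrite PhiSp PhiS /rank_one eta1 scale1r.
have UsU u : Us (U u) = u.
  apply/eqP; rewrite -subr_eq0; apply/eqP/rnorm0_eq0.
  by rewrite -Unorm lin_sub// UUs subrr rnorm0.
exists U, Us; split.
  split.
  - apply/bounded_operatorP; split=> //; exists 1 => // u.
    by rewrite mul1r Unorm.
  - by move=> u v; rewrite -{1}(UUs v) Uinner.
  - exact/funext.
  - exact/funext.
(* [T \o rank_one u d0] is [rank_one (T u) d0], so [Phi T] sends [U u] to [U (T u)]. *)
move=> T ET; apply/funext => v; rewrite /= -{1}(UUs v) /U.
rewrite -[Phi T (Phi _ eta)]/((Phi T \o Phi (rank_one (Us v) d0)) eta).
by rewrite -(Phi_comp _ _ ET (rE _ _)) (rank_one_comp _ _ (roe_lin _ ET)).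
Qed.

End spatial_implementation.

(** * Both infima, and the case of empty spaces *)

Lemma ereal_inf_sup_gt0 (R : realType) (I J : Type) (c : I -> J -> R) (d : R) :
  0 < d -> (forall i, exists j, d <= c i j) ->
  (0 < ereal_inf [set ereal_sup [set (c i j)%:E | j in [set: J]] | i in [set: I]])%E.
Proof.
move=> d0 dc; apply: (@lt_le_trans _ _ d%:E); first by rewrite lte_fin.
apply/ereal_infP => _ [i _ <-]; have [j dij] := dc i.
apply: (@le_trans _ _ (c i j)%:E); first by rewrite lee_fin.
by apply: ereal_sup_ubound; exists j.
Qed.

Lemma ell2_empty (R : realType) (X : choiceType) (u v : ell2 R X) :
  (X -> False) -> u = v.
Proof. by move=> noX; apply: ell2_ext => x; case: (noX x). Qed.

Theorem theorem7p4 (R : realType) (X Y : choiceType)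
    (E : set (set (X * X))) (F : set (set (Y * Y)))
    (hE : coarse_structure E) (hF : coarse_structure F)
    (ulfE : uniformly_locally_finite E) (ulfF : uniformly_locally_finite F)
    (embE : coarsely_embeds_into_hilbert R E)
    (embF : coarsely_embeds_into_hilbert R F)
    (Phi : (ell2 R X -> ell2 R X) -> (ell2 R Y -> ell2 R Y))
    (hPhi : star_isomorphism (uniform_roe R E) (uniform_roe R F) Phi) :
  rigidly_implemented (uniform_roe R E) Phi.
Proof.
have conE := hilbert_embedding_connected hE embE.
have conF := hilbert_embedding_connected hF embF.
have [[PhiF Phi_inj Phi_surj] _ _ _] := hPhi.
(* If [X] is empty, its only operator has both the identity and zero on [Y] as images, so [Y] is
   empty too and zero maps serve as the unitary. *)
have [[x0 _]|/forallNP noX] := pselect (exists x : X, True); last first.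
  have noX' (x : X) : False by exact: (noX x).
  have noY (y : Y) : False.
    have [S _ S1] := Phi_surj _ (restr_uniform_roe R hF setT).
    have [T _ T0] := Phi_surj _ (restr_uniform_roe R hF set0).
    have ST : S = T by apply/funext => u; exact: ell2_empty.
    have := congr1 (fun f : ell2 R Y -> ell2 R Y => f (delta R y) y)
      (etrans (esym S1) (etrans (congr1 Phi ST) T0)).
    rewrite !restrE mem_set// memNset//= eqxx => /eqP.
    by rewrite oner_eq0.
  exists (fun=> 0), (fun=> 0); split.
  - split.
    + apply/bounded_operatorP; split=> [a u v|]; first exact: ell2_empty.
      by exists 0 => // u; rewrite rnorm0 mul0r.
    + by move=> u v; rewrite inner0l inner0r.
    + by apply/funext => u; exact: ell2_empty.
    + by apply/funext => u; exact: ell2_empty.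
  - by move=> T _; apply/funext => u; exact: ell2_empty.
  - by apply: (ereal_inf_sup_gt0 ltr01) => x; case: (noX' x).
  - by apply: (ereal_inf_sup_gt0 ltr01) => y; case: (noY y).
have [U [Us [unitU PhiU]]] := isomorphism_spatial hE hF conE conF hPhi x0.
have [bU adjU UsU UUs] := unitU.
have UsUE u : Us (U u) = u := congr1 (fun f => f u) UsU.
have UUsE v : U (Us v) = v := congr1 (fun f => f v) UUs.
have adjUs : is_adjoint Us U.
  by move=> v u; rewrite inner_conj -adjU -inner_conj.
have Unorm u : rnorm (U u) = rnorm u.
  apply/eqP; rewrite -(@eqrXn2 _ 2)// ?rnorm_ge0//; apply/eqP/complexI.
  by rewrite -!inner_self adjU UsUE.
have Usnorm v : rnorm (Us v) = rnorm v by rewrite -Unorm UUsE.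
exists U, Us; split=> //.
- have [|d d0 Ud] := unitary_coefficients_bounded_below hF ulfF embF Unorm adjU.
    by move=> A; rewrite -PhiU; [apply: PhiF|]; exact: restr_uniform_roe.
  exact: ereal_inf_sup_gt0 d0 Ud.
(* For [Us] the membership comes from surjectivity: the preimage of [restr A] under [Phi] is
   [Us \o restr A \o U]. *)
- have [|d d0 Ud] := unitary_coefficients_bounded_below hE ulfE embE Usnorm adjUs.
    move=> A; have [S ES SA] := Phi_surj _ (restr_uniform_roe R hF A).
    have -> : Us \o restr A \o U = S; last exact ES.
    have PhiS := PhiU S ES; apply/funext => u.
    by rewrite /= -SA PhiS /= !UsUE.
  exact: ereal_inf_sup_gt0 d0 Ud.
Qed.
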